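(* Let $K$ be a number field, $p$ a prime number and $\zeta\in\mathbb{C}$ a primitive $p$-th root of unity, and assume $\zeta\notin K$ and that $p$ is unramified in $K$. Let $L=K(\alpha)$ be an extension of $K$ of degree $p$, where $\alpha\in\mathfrak{O}_L$ satisfies $a:=\alpha^p\in\mathfrak{O}_K$ and $a\equiv 1 \pmod{p^2\mathfrak{O}_K}$, and assume $L/K$ is at most tamely ramified. Let $H$ be the $K$-Hopf algebra giving the Hopf–Galois structure on $L/K$ described in the context, and let $\mathfrak{A}=\{h\in H : h\cdot\mathfrak{O}_L\subseteq\mathfrak{O}_L\}$ be the associated order of $\mathfrak{O}_L$ in $H$. Then $\mathfrak{O}_L$ is a free $\mathfrak{A}$-module if and only if there exists $\beta\in\mathfrak{O}_L$ such that (1) $L=K(\beta)$; (2) $b:=\beta^p\in\mathfrak{O}_K$; (3) the ideals $\mathfrak{b}_0,\dots,\mathfrak{b}_{p-1}$ associated to $b\mathfrak{O}_K$ are all principal, with generators $b_0,\dots,b_{p-1}$ (i.e. $\mathfrak{b}_j=b_j\mathfrak{O}_K$) such that $\sum_{j=0}^{p-1}\beta^j/b_j\in p\,\mathfrak{O}_L$. Furthermore, in this case the element $\frac{1}{p}\sum_{j=0}^{p-1}\beta^j/b_j$ is a free generator of $\mathfrak{O}_L$ as an $\mathfrak{A}$-module.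
   Context: $\mathfrak{O}_K,\mathfrak{O}_L$ denote rings of integers. For a nonzero ideal $\mathfrak{c}$ of $\mathfrak{O}_K$, the ideals associated to $\mathfrak{c}$ are $\mathfrak{b}_j=\prod_{\mathfrak{p}}\mathfrak{p}^{\lfloor j\,v_{\mathfrak{p}}(\mathfrak{c})/p\rfloor}$ for $0\le j\le p-1$ (product over prime ideals $\mathfrak{p}$ of $\mathfrak{O}_K$, $v_{\mathfrak{p}}$ the $\mathfrak{p}$-adic valuation). The Hopf–Galois structure: let $E=K(\alpha,\zeta)$ (the Galois closure of $L/K$) and $G=\mathrm{Gal}(E/K)$, generated by $\sigma,\tau$ with $\sigma(\alpha)=\zeta\alpha$, $\sigma(\zeta)=\zeta$, $\tau(\alpha)=\alpha$, $\tau(\zeta)=\zeta^d$ for a fixed primitive root $d$ mod $p$. Let $G'=\langle\tau\rangle$, $X=G/G'$ the set of left cosets, $\bar\sigma^i=\sigma^iG'$ ($i=0,\dots,p-1$, which exhaust $X$), and $\lambda:G\to\mathrm{Perm}(X)$ left translation. Let $\eta\in\mathrm{Perm}(X)$ be $\eta(\bar\sigma^i)=\bar\sigma^{i-1}$ (indices mod $p$) and $N=\langle\eta\rangle$. $G$ acts on the group algebra $E[N]$ by $g\cdot\sum_n c_n n=\sum_n g(c_n)\,\lambda(g)n\lambda(g)^{-1}$, and $H=E[N]^G$; it acts on $L$ by $\left(\sum_{k=0}^{p-1}c_k\eta^k\right)\cdot x=\sum_{k=0}^{p-1}c_k\sigma^k(x)$. (This is the unique Hopf–Galois structure on $L/K$.)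 *)

(* Defs.v *)
From HB Require Import structures.
From mathcomp Require Import all_boot all_order all_algebra all_fingroup.
From mathcomp Require Import all_solvable all_field.
From mathcomp Require Import mathcomp_extra boolp classical_sets functions.
From mathcomp Require Import cardinality fsbigop.

Set Implicit Arguments.
Unset Strict Implicit.
Unset Printing Implicit Defensive.

Import GRing.Theory.
Local Open Scope ring_scope.
Local Open Scope classical_set_scope.

(* Ideals of a subring O of a field F are represented by sets of elements of F.
   The ring O is always one of the rings of integers below. *)

Definition algebraic_integers (F : fieldType) : set F :=
  [set x : F | integralOver (intr : int -> F) x].

Definition integers_of (F : fieldType) (E : fieldExtType F) (L : {vspace E}) :
  set E := [set x : E | x \in L /\ algebraic_integers x].

Record is_ideal (F : fieldType) (O I : set F) : Prop := IsIdeal {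
  ideal_sub : I `<=` O;
  ideal_0 : I 0;
  ideal_add : forall x y, I x -> I y -> I (x + y);
  ideal_mul : forall r x, O r -> I x -> I (r * x) }.

Definition principal_ideal (F : fieldType) (O : set F) (x : F) : set F :=
  [set x * r | r in O].

Definition mul_ideal (F : fieldType) (I J : set F) : set F :=
  [set x | exists2 s : seq (F * F),
     forall u, u \in s -> I u.1 /\ J u.2 & x = \sum_(u <- s) u.1 * u.2].

Definition exp_ideal (F : fieldType) (O I : set F) (n : nat) : set F :=
  iter n (mul_ideal I) O.

(* The zero ideal is excluded, so these are the primes that occur in
   factorizations of nonzero ideals. *)
Record is_prime_ideal (F : fieldType) (O P : set F) : Prop := IsPrimeIdeal {
  prime_ideal_ideal : is_ideal O P;
  prime_ideal_proper : ~ P 1;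
  prime_ideal_nonzero : exists2 x, P x & x != 0;
  prime_ideal_mul : forall x y, O x -> O y -> P (x * y) -> P x \/ P y }.

Definition dvd_ideal (F : fieldType) (O I J : set F) : Prop :=
  exists2 D, is_ideal O D & J = mul_ideal I D.

(* The largest n such that P ^ n divides I (only meaningful for I nonzero). *)
Definition ideal_val (F : fieldType) (O P I : set F) : nat :=
  xget 0%N [set n : nat | dvd_ideal O (exp_ideal O P n) I /\
    forall m : nat, dvd_ideal O (exp_ideal O P m) I -> (m <= n)%N].

(* The product over all primes is the finitely supported big operator: only
   finitely many factors differ from O when c is nonzero. *)
Definition associated_ideal (F : fieldType) (O : set F) (p : nat) (c : set F)
    (j : nat) : set F :=
  \big[@mul_ideal F/O]_(P \in [set P | is_prime_ideal O P])
     exp_ideal O P ((j * ideal_val O P c) %/ p).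

Definition unramified_in (K : fieldType) (p : nat) : Prop :=
  let OK := @algebraic_integers K in
  forall P, is_prime_ideal OK P -> P p%:R ->
    ideal_val OK P (principal_ideal OK p%:R) = 1%N.

(* The ramification index of Q over its restriction to O_K. *)
Definition ram_index (K : fieldType) (E : fieldExtType K) (L : {vspace E})
    (Q : set E) : nat :=
  let P := [set x : K | algebraic_integers x /\ Q x%:A] in
  let OL := integers_of L in
  ideal_val OL Q (mul_ideal (in_alg E @` P) OL).

(* l is the residue characteristic of Q; residue fields are finite, so the
   separability of the residue extension is automatic. *)
Definition tamely_ramified (K : fieldType) (E : fieldExtType K)
    (L : {vspace E}) : Prop :=
  forall (Q : set E) (l : nat), is_prime_ideal (integers_of L) Q ->
    prime l -> Q l%:R -> ~~ (l %| ram_index L Q)%N.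

(* Products in gal_of are written in diagrammatic order: (x * y)%g is "x, then
   y", i.e. y o x.  Hence the left coset g o G' of the usual convention is the
   right coset (G' :* g)%g, and left translation by g is right multiplication
   by g, i.e. the action 'Rs.  Products in {perm _} are diagrammatic as well,
   so that lambda(g) o n o lambda(g)^-1 is the conjugate (n ^ lambda g)%g. *)
Section HopfGalois.

Local Open Scope group_scope.

Definition gal_group (K : fieldType) (E : splittingFieldType K) :
  {set gal_of {:E}} := 'Gal({:E} / 1).

Definition cosets (K : fieldType) (E : splittingFieldType K)
    (tau : gal_of {:E}) : {set {set gal_of {:E}}} :=
  rcosets <[tau]> (gal_group E).

(* An element of Perm(X) is a permutation of all subsets of G with support in X. *)
Definition translation (K : fieldType) (E : splittingFieldType K)
    (tau g : gal_of {:E}) : {perm {set gal_of {:E}}} :=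
  restr_perm (cosets tau) (actperm 'Rs g).

Definition is_eta (K : fieldType) (E : splittingFieldType K)
    (sigma tau : gal_of {:E}) (eta : {perm {set gal_of {:E}}}) : Prop :=
  perm_on (cosets tau) eta /\
  forall i : nat, eta (<[tau]> :* sigma ^+ i.+1) = <[tau]> :* sigma ^+ i.

(* An element of E[N] is given by its coefficients, extended by 0 to all
   permutations. *)
Definition perm_algebra (K : fieldType) (E : splittingFieldType K) : Type :=
  {ffun {perm {set gal_of {:E}}} -> E}.

(* The coefficient of g . (\sum_n c_n n) at m comes from the n with
   lambda(g) n lambda(g)^-1 = m. *)
Definition gal_act (K : fieldType) (E : splittingFieldType K)
    (tau g : gal_of {:E}) (c : perm_algebra E) : perm_algebra E :=
  [ffun m => g (c (m ^ (translation tau g)^-1))].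

Definition hopf_algebra (K : fieldType) (E : splittingFieldType K)
    (tau : gal_of {:E}) (eta : {perm {set gal_of {:E}}}) :
    set (perm_algebra E) :=
  [set c : perm_algebra E | (forall n, n \notin <[eta]> -> c n = 0%R) /\
    (forall g, g \in gal_group E -> gal_act tau g c = c)].

Definition hopf_act (K : fieldType) (E : splittingFieldType K) (p : nat)
    (sigma : gal_of {:E}) (eta : {perm {set gal_of {:E}}})
    (c : perm_algebra E) (x : E) : E :=
  (\sum_(k < p) c (eta ^+ k)%g * (sigma ^+ k)%g x)%R.

Definition associated_order (K : fieldType) (E : splittingFieldType K)
    (p : nat) (sigma tau : gal_of {:E}) (eta : {perm {set gal_of {:E}}})
    (L : {vspace E}) : set (perm_algebra E) :=
  [set h : perm_algebra E | hopf_algebra tau eta h /\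
           forall x, integers_of L x ->
             integers_of L (hopf_act p sigma eta h x)].

End HopfGalois.

(* B is a basis of M as a module over A, for the action act : A -> M -> M. *)
Record is_module_basis (H : zmodType) (V : zmodType) (act : H -> V -> V)
    (A : set H) (M B : set V) : Prop := IsModuleBasis {
  basis_sub : B `<=` M;
  basis_span : forall y, M y -> exists (s : seq V) (h : V -> H),
    (forall x, x \in s -> B x /\ A (h x)) /\ y = \sum_(x <- s) act (h x) x;
  basis_free : forall (s : seq V) (h : V -> H), uniq s ->
    (forall x, x \in s -> B x /\ A (h x)) ->
    \sum_(x <- s) act (h x) x = 0 -> forall x, x \in s -> h x = 0 }.

Definition is_free_module (H : zmodType) (V : zmodType) (act : H -> V -> V)
    (A : set H) (M : set V) : Prop :=
  exists B : set V, is_module_basis act A M B.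

Definition is_free_generator (H : zmodType) (V : zmodType) (act : H -> V -> V)
    (A : set H) (M : set V) (x : V) : Prop :=
  is_module_basis act A M [set x].

Definition kummer_sum (K : fieldType) (E : fieldExtType K) (p : nat)
    (beta : E) (bs : 'I_p -> K) : E :=
  \sum_(j < p) beta ^+ j / (bs j)%:A.

Record freeness_data (K : fieldType) (E : fieldExtType K) (p : nat)
    (L : {vspace E}) (beta : E) (b : K) (bs : 'I_p -> K) : Prop :=
  FreenessData {
    fd_int : integers_of L beta;
    fd_gen : <<1; beta>>%VS = L;
    fd_intb : algebraic_integers b;
    fd_pow : beta ^+ p = b%:A;
    fd_intbs : forall j, algebraic_integers (bs j);
    fd_principal : forall j : 'I_p,
      let OK := @algebraic_integers K in
      associated_ideal OK p (principal_ideal OK b) j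
      = principal_ideal OK (bs j);
    fd_dvd : exists2 y, integers_of L y & kummer_sum beta bs = p%:R * y }.

(* Main.v *)
Require Import Defs.
From HB Require Import structures.
From mathcomp Require Import all_boot all_order all_algebra all_fingroup.
From mathcomp Require Import all_solvable all_field.
From mathcomp Require Import mathcomp_extra boolp classical_sets functions.
From mathcomp Require Import cardinality fsbigop.
From mathcomp Require Import ring.

(** The Hopf algebra acts on L = K(alpha) by K-linear maps that are diagonal in
    the basis alpha^j, and every such diagonal map occurs: h corresponds to its
    eigenvalues sum_k h(eta^k) zeta^(jk), which lie in K by Galois invariance.
    Let B_j be the set of integers in K alpha^j.  Every integer of L is
    1/p sum_j u_j with u_j in B_j, and such a mean is integral if and only if
    all u_j are congruent modulo 1 - zeta.  This is a Fourier computation in one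
    direction; in the other it uses that alpha = 1 modulo 1 - zeta, that
    1/p sum_j alpha^j = prod_k (alpha - zeta^k) / (1 - zeta^k) is integral, and
    that p O_K is a radical ideal.  It follows that O_L is free if and only if
    B_j = O_K u_j for some u_j whose mean is integral, and the mean is then a
    generator.  Taking beta = u_1, unique factorization of ideals of O_K turns
    B_j = O_K beta^j / b_j into the statement that b_j generates the j-th
    associated ideal. *)

Set Implicit Arguments.
Unset Strict Implicit.
Unset Printing Implicit Defensive.

Import GRing.Theory Num.Theory.
Local Open Scope ring_scope.

(** All ideal theory takes place over K. In E only integrality of elements is used, and a congruence
    modulo 1 - zeta is expressed as integrality of a quotient by [pi]. The bridge back to K is that
    p and (1 - zeta)^(p-1) are associates: if 1 - zeta divides some k in O_K, then p divides
    k^(p-1), hence k, because p is unramified. The associated order becomes the set of eigenvalue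
    vectors that preserve O_L. It contains p times the projection onto each line K alpha^j and,
    because 1/p sum_j alpha^j is integral, every member supported on one line is an O_K-multiple of
    that. Hence a generator theta gives B_j = O_K u_j with u_j equal to p times the j-th component
    of theta. Conversely, a generator u_j of B_j divides alpha^j, so it is invertible modulo 1 -
    zeta, which lets congruences between coordinates be multiplied. The associated ideals enter
    because k beta^j is integral exactly when its p-th power k^p b^j is, and this is a floor
    inequality between valuations. *)

Definition Oint (F : fieldType) : {pred F} := fun x => `[< algebraic_integers x >].
Arguments Oint : clear implicits.

(** * Algebraic integers of a field *)

Section Integrality.
Variable F : fieldType.

Lemma OintP (x : F) : reflect (algebraic_integers x) (x \in Oint F).
Proof. exact: asboolP. Qed.

Lemma Oint_subring_closed : subring_closed (Oint F).
Proof.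
split; first exact/OintP/integral1.
- by move=> x y /OintP Ox /OintP Oy; apply/OintP/integral_sub.
- by move=> x y /OintP Ox /OintP Oy; apply/OintP/integral_mul.
Qed.

HB.instance Definition _ :=
  GRing.isSubringClosed.Build F (Oint F) Oint_subring_closed.

Lemma Oint_root_monic (q : {poly F}) (x : F) :
  q \is monic -> root q x -> q \is a polyOver (Oint F) -> x \in Oint F.
Proof.
move=> mon_q qx0 /allP Oq; apply/OintP; apply: integral_root_monic mon_q qx0 _.
by move=> y /Oq /OintP.
Qed.

Lemma OintX (n : nat) (x : F) : (0 < n)%N -> x ^+ n \in Oint F -> x \in Oint F.
Proof.
move=> n_gt0 Oxn; apply: (@Oint_root_monic ('X^n - (x ^+ n)%:P)).
- by rewrite monicXnsubC.
- by rewrite rootE !hornerE subrr.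
- by rewrite rpredB ?polyOverXn ?polyOverC.
Qed.

End Integrality.

(** A field morphism fixes integer polynomials and is injective, so both sides concern the same
    monic equations. *)
Lemma Oint_rmorph (F F' : fieldType) (f : {rmorphism F -> F'}) (x : F) :
  (f x \in Oint F') = (x \in Oint F).
Proof.
apply/OintP/OintP => -[q mon_q qx0]; exists q => //.
  move: qx0; rewrite (_ : map_poly intr q = map_poly f (map_poly intr q)).
    by rewrite fmorph_root.
  by rewrite -map_poly_comp; apply: eq_map_poly => n /=; rewrite rmorph_int.
rewrite (_ : map_poly intr q = map_poly f (map_poly intr q)) ?fmorph_root //.
by rewrite -map_poly_comp; apply: eq_map_poly => n /=; rewrite rmorph_int.
Qed.

Lemma Oint_alg (K : fieldType) (E : fieldExtType K) (k : K) :
  (k%:A \in Oint E) = (k \in Oint K).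
Proof. by rewrite -(Oint_rmorph (in_alg E)). Qed.

Lemma rat_common_denominator (I : finType) (q : I -> rat) :
  exists2 m : nat, (0 < m)%N & exists c : I -> int, forall i, m%:R * q i = (c i)%:~R.
Proof.
exists (\prod_i `|denq (q i)|)%N.
  by apply: prodn_gt0 => i; rewrite absz_gt0 denq_neq0.
exists (fun i => numq (q i) * (\prod_(j | j != i) `|denq (q j)|)%N%:Z) => i.
rewrite (bigD1 i) //= natrM rmorphM /= mulrAC -pmulrn; congr (_ * _).
rewrite numqE mulrC pmulrn absz_denq; congr (_ * _).
Qed.

(** * Denominators in a number field *)

Section NumberField.
Variable K : fieldExtType rat.

Lemma ratr_scale (q : rat) (x : K) (m : nat) (c : int) :
  m%:R * q = c%:~R -> m%:R * (q *: x) = c%:~R * x.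
Proof.
move=> mq; rewrite -[m%:R]mulr1 mulr_natl -scaler_nat -scalerAl mul1r scalerA mq.
by rewrite scaler_int mulrzl.
Qed.

Lemma nat_neq0 (n : nat) : (0 < n)%N -> n%:R != 0 :> K.
Proof.
move=> n_gt0; rewrite -scaler_nat scaler_eq0 oner_eq0 orbF pnatr_eq0.
by rewrite -lt0n.
Qed.

Lemma Oint_fraction (x : K) :
  exists2 m : nat, (0 < m)%N & m%:R * x \in Oint K.
Proof.
have [q mon_q qx0 ] : exists2 q : {poly rat}, q \is monic & root (map_poly (in_alg K) q) x.
  have /polyOver1P[q Dq] := minPolyOver 1%AS x; exists q; last by rewrite -Dq root_minPoly.
  by rewrite -(map_monic (in_alg K)) -Dq monic_minPoly.
have [m m_gt0 [c mq]] := rat_common_denominator (fun i : 'I_(size q) => q`_i).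
exists m => //; set n := (size q).-1.
have sz_q : size q = n.+1 by rewrite prednK // size_poly_gt0 monic_neq0.
(* This is m^n q(X / m), with root m x. Below degree n at least one factor m is left to clear the
   denominator of the coefficient. *)
apply: (@Oint_root_monic _
  ('X^n + \poly_(i < n) (m%:R ^+ (n - i) * (q`_i)%:A))).
- rewrite monicE lead_coefDl ?lead_coefXn // size_polyXn ltnS.
  exact: size_poly.
- apply/eqP; rewrite !hornerE horner_poly /=.
  move/eqP: qx0; rewrite (horner_coef_wide x (n := n.+1)); last first.
    by rewrite size_map_poly sz_q.
  rewrite big_ord_recr /= !coef_map /= -/n.
  have -> : q`_n = 1 by move/eqP: mon_q; rewrite lead_coefE.
  rewrite scale1r mul1r => qx0.
  rewrite -[RHS](mulr0 (m%:R ^+ n)) -[in RHS]qx0 [RHS]mulrDr -exprMn mulr_sumr.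
  rewrite [LHS]addrC; congr (_ + _); apply: eq_bigr => i _.
  rewrite coef_map /= exprMn mulrACA -exprD subnK //; exact/ltnW.
- rewrite rpredD ?polyOverXn //; apply/polyOver_poly => i lt_i_n.
  have [k ->] : exists k, (n - i = k.+1)%N by exists (n - i).-1; rewrite prednK ?subn_gt0.
  have lt_i : (i < size q)%N by rewrite sz_q ltnS ltnW.
  rewrite exprSr -mulrA (ratr_scale _ (mq (Ordinal lt_i))) mulr1.
  by rewrite rpredM ?rpredX ?rpred_nat ?rpred_int.
Qed.


End NumberField.

(** * Finiteness of O_K / n O_K and complete integral closedness *)

Section FiniteQuotients.
Variable K : fieldExtType rat.

(** For integral [x] and prime [l], this is linear independence over F_l of the classes of the [x i]
    in O_K / l O_K. *)
Definition independent_mod (l k : nat) (x : 'I_k -> K) :=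
  forall (c : 'I_k -> int) (y : K), y \in Oint K ->
    \sum_i (c i)%:~R * x i = l%:R * y -> forall i, (l %| c i)%Z.

(** Independence modulo [l] implies independence over the rationals. This bounds the dimension of
    O_K / l O_K without an integral basis. *)
Lemma independent_mod_leq (l k : nat) (x : 'I_k -> K) :
  (1 < l)%N -> independent_mod l x -> (k <= \dim {:K})%N.
Proof.
move=> l_gt1 ind_x.
have l_neq0 : l%:R != 0 :> K by rewrite nat_neq0 // ltnW.
(* An integral relation is divisible by l, hence by every power of l. *)
have ind0 n c : \sum_i (c i)%:~R * x i = 0 -> forall i, ((l ^ n)%N%:Z %| c i)%Z.
  elim: n c => [|n IHn] c c0 i; first by rewrite expn0 dvd1z.
  have c1 : forall i, (c i = (c i %/ l)%Z * l)%R.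
    by move=> j; rewrite divzK // (ind_x c 0) ?rpred0 ?mulr0.
  rewrite c1 expnSr PoszM dvdz_mul //; apply: (IHn (fun i => (c i %/ l)%Z)).
  apply: (mulfI l_neq0); rewrite mulr0 -[RHS]c0 mulr_sumr; apply: eq_bigr => j _.
  by rewrite [in RHS]c1 intrM mulrA [l%:R * _]mulrC.
have c_eq0 c : \sum_i (c i)%:~R * x i = 0 -> forall i, c i = 0.
  move=> c0 i; apply/eqP; rewrite -absz_eq0; case: posnP => // ci_gt0.
  have := ind0 `|c i|%N c c0 i; rewrite dvdzE /= => /(dvdn_leq ci_gt0).
  by rewrite leqNgt ltn_expl.
have frX : free [tuple x i | i < k].
  apply/freeP => q q0 i; have [m m_gt0 [c mq]] := rat_common_denominator q.
  have cx0 : \sum_i (c i)%:~R * x i = 0.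
    rewrite -[RHS](mulr0 m%:R) -[in RHS]q0 mulr_sumr; apply: eq_bigr => j _.
    by rewrite -tnth_nth tnth_mktuple (ratr_scale _ (mq j)).
  apply/eqP; have := mq i; rewrite (c_eq0 _ cx0) => /eqP.
  by rewrite mulf_eq0 pnatr_eq0 eqn0Ngt m_gt0.
have := dimvS (subvf <<[tuple x i | i < k]>>%VS).
by move: frX; rewrite /free size_tuple => /eqP ->.
Qed.

(** Take an independent family modulo [l] of maximal size. Adding [y] creates a relation whose
    coefficient at [y] is prime to [l], and Bezout solves it for [y]. *)
Lemma Oint_finite_mod_prime (l : nat) : prime l ->
  exists k (x : 'I_k -> K), (forall i, x i \in Oint K) /\
    forall y, y \in Oint K -> exists (c : 'I_k -> int) (z : K),
      z \in Oint K /\ y = \sum_i (c i)%:~R * x i + l%:R * z.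
Proof.
move=> l_pr; pose Q k := exists x : 'I_k -> K,
  (forall i, x i \in Oint K) /\ independent_mod l x.
have exQ : exists k, `[< Q k >].
  by exists 0%N; apply/asboolP; exists (fun=> 0); split => [[]|c y _ _ []].
have bndQ k : `[< Q k >] -> (k <= \dim {:K})%N.
  by case/asboolP => x [_]; apply: independent_mod_leq (prime_gt1 l_pr).
case: (ex_maxnP exQ bndQ) => k /asboolP[x [Ox ind_x]] max_k.
exists k, x; split => // y Oy.
pose x' (i : 'I_k.+1) := if unlift ord_max i is Some j then x j else y.
have x'max : x' ord_max = y by rewrite /x' unlift_none.
have x'lift j : x' (widen_ord (leqnSn k) j) = x j.
  have -> : widen_ord (leqnSn k) j = lift ord_max j.
    by apply: val_inj; rewrite /= /bump leqNgt ltn_ord.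
  by rewrite /x' liftK.
have [c [z [Oz Dz]] ndvd_c] : exists2 c : 'I_k.+1 -> int,
    exists z, z \in Oint K /\ \sum_i (c i)%:~R * x' i = l%:R * z &
    ~ forall i, (l %| c i)%Z.
  apply: contrapT => no_c; suff: (k.+1 <= k)%N by rewrite ltnn.
  apply/max_k/asboolP; exists x'; split.
    by move=> i; rewrite /x'; case: unlift.
  move=> c z Oz Dz; apply: contrapT => ndvd.
  by apply: no_c; exists c => //; exists z.
rewrite big_ord_recr /= x'max in Dz.
rewrite (eq_bigr (fun j => (c (widen_ord (leqnSn k) j))%:~R * x j)) in Dz;
  last by move=> j _; rewrite x'lift.
(* If [l] divided the coefficient of [y], a relation modulo [l] among the [x i] would remain, and
   their independence would make all coefficients divisible. *)
have co_c : coprimez l (c ord_max).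
  rewrite coprimezE /= prime_coprime //; apply/negP => dvd_l.
  apply: ndvd_c; have dvd_max : (l %| c ord_max)%Z by rewrite dvdzE.
  have /dvdzP[m Dm] := dvd_max.
  have dvd_i : forall i, (l %| c (widen_ord (leqnSn k) i))%Z.
    apply: (ind_x (fun i => c (widen_ord _ i)) (z - m%:~R * y)).
      by rewrite rpredB ?rpredM ?rpred_int.
    apply: (addIr ((c ord_max)%:~R * y)); rewrite Dz Dm intrM mulrBr.
    by rewrite -[_ * l%:~R * y]mulrA mulrCA -pmulrn subrK.
  move=> i; case: (unliftP ord_max i) => [j ->|-> //].
  have -> : lift ord_max j = widen_ord (leqnSn k) j.
    by apply: val_inj; rewrite /= /bump leqNgt ltn_ord.
  exact: dvd_i.
have [u [v Duv]] := Bezoutz l (c ord_max).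
have {Duv} Duv : u%:~R * l%:R + v%:~R * (c ord_max)%:~R = 1 :> K.
  move/eqP: co_c Duv => -> /(congr1 (fun n => n%:~R : K)).
  by rewrite intrD !intrM -pmulrn.
exists (fun i => - v * c (widen_ord (leqnSn k) i)), (u%:~R * y + v%:~R * z).
split; first by rewrite rpredD ?rpredM ?rpred_int.
have Dy : (c ord_max)%:~R * y =
    l%:R * z - \sum_(i < k) (c (widen_ord (leqnSn k) i))%:~R * x i.
  by rewrite -Dz addrAC subrr add0r.
have -> : \sum_i (- v * c (widen_ord (leqnSn k) i))%:~R * x i =
    - (v%:~R * \sum_i (c (widen_ord (leqnSn k) i))%:~R * x i).
  rewrite mulr_sumr -sumrN; apply: eq_bigr => i _.
  by rewrite mulNr rmorphN /= intrM mulNr mulrA.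
transitivity ((u%:~R * l%:R + v%:~R * (c ord_max)%:~R) * y).
  by rewrite Duv mul1r.
rewrite mulrDl -!mulrA Dy mulrBr [RHS]addrC addrA; congr (_ - _).
by rewrite mulrDr; congr (_ + _); exact: mulrCA.
Qed.

Lemma Oint_reps_prime (l : nat) : prime l -> exists2 s : seq K,
  {subset s <= Oint K} & forall x, x \in Oint K ->
    exists2 r, r \in s & exists2 y, y \in Oint K & x = r + l%:R * y.
Proof.
move=> l_pr; have [k [x [Ox spanx]]] := Oint_finite_mod_prime l_pr.
have l_gt0 := prime_gt0 l_pr.
pose comb (f : {ffun 'I_k -> 'I_l}) := \sum_i (f i)%:R * x i.
exists [seq comb f | f : {ffun 'I_k -> 'I_l}].
  by move=> _ /mapP[f _ ->]; rewrite rpred_sum // => i _; rewrite rpredM ?rpred_nat.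
move=> y /spanx[c [z [Oz ->]]].
have lt_r i : (`|(c i %% l)%Z| < l)%N.
  rewrite -ltz_nat gez0_abs ?modz_ge0 ?ltz_mod ?ltz_pmod //; by case: (l) l_gt0.
exists (comb [ffun i => Ordinal (lt_r i)]).
  by apply: map_f; rewrite mem_enum.
exists (\sum_i ((c i %/ l)%Z)%:~R * x i + z).
  by rewrite rpredD // rpred_sum // => i _; rewrite rpredM ?rpred_int.
rewrite mulrDr addrA; congr (_ + _); rewrite mulr_sumr -big_split /=.
apply: eq_bigr => i _; rewrite ffunE /= mulrA -mulrDl; congr (_ * _).
rewrite {1}(divz_eq (c i) l) intrD intrM addrC mulrC pmulrn gez0_abs //.
by rewrite modz_ge0 //; case: (l) l_gt0.
Qed.

(** Split off a prime factor l of n: digits r1 modulo l and r2 modulo n / l combine to r1 + l r2. *)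
Lemma Oint_reps (n : nat) : (0 < n)%N -> exists2 s : seq K,
  {subset s <= Oint K} & forall x, x \in Oint K ->
    exists2 r, r \in s & exists2 y, y \in Oint K & x = r + n%:R * y.
Proof.
elim/ltn_ind: n => n IHn n_gt0; have [n_le1|n_gt1] := leqP n 1.
  exists [:: 0] => [r | x Ox]; first by rewrite mem_seq1 => /eqP->; apply: rpred0.
  exists 0; rewrite ?inE //; exists x => //.
  by rewrite (_ : n = 1%N) ?mul1r ?add0r //; case: n n_gt0 n_le1 {IHn} => [|[]].
have l_pr := pdiv_prime n_gt1; have [m Dn] := dvdnP (pdiv_dvd n).
have [s1 Os1 reps1] := Oint_reps_prime l_pr.
have m_gt0 : (0 < m)%N by move: n_gt0; rewrite Dn muln_gt0 => /andP[].
have lt_m_n : (m < n)%N by rewrite [ltnRHS]Dn ltn_Pmulr ?prime_gt1.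
have [s2 Os2 reps2] := IHn m lt_m_n m_gt0.
exists [seq r1 + (pdiv n)%:R * r2 | r1 <- s1, r2 <- s2].
  move=> _ /allpairsP[[r1 r2] /= [s1r1 s2r2 ->]].
  apply: rpredD; first exact: Os1.
  by apply: rpredM; [apply: rpred_nat | apply: Os2].
move=> x /reps1[r1 s1r1 [y /reps2[r2 s2r2 [z Oz ->]] ->]].
exists (r1 + (pdiv n)%:R * r2); first exact: allpairs_f.
by exists z; rewrite // mulrDr addrA mulrA -natrM mulnC -Dn.
Qed.

Lemma Oint_pigeonhole (n : nat) (x : nat -> K) : (0 < n)%N ->
  (forall i, x i \in Oint K) ->
  exists i j, (i < j)%N /\ exists2 y, y \in Oint K & x j - x i = n%:R * y.
Proof.
move=> n_gt0 Ox; have [s Os reps] := Oint_reps n_gt0.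
have reps' i : exists k : 'I_(size s), exists2 y, y \in Oint K & x i = s`_k + n%:R * y.
  have [r s_r [y Oy ->]] := reps _ (Ox i).
  have lt_r : (index r s < size s)%N by rewrite index_mem.
  by exists (Ordinal lt_r), y; rewrite //= nth_index.
pose f (i : 'I_(size s).+1) := sval (cid (reps' i)).
have [i [j [neq_ij eq_f]]] : exists i j, i != j /\ f i = f j.
  apply: contrapT => inj_f; suff: (size s < size s)%N by rewrite ltnn.
  have /leq_card : injective f; last by rewrite !card_ord.
  move=> i j eq_f; apply: contrapT => neq_ij; apply: inj_f; exists i, j.
  by split=> //; apply/eqP.
have Df (k : 'I_(size s).+1) : exists2 y, y \in Oint K & x k = s`_(f k) + n%:R * y.
  exact: (svalP (cid (reps' k))).
wlog lt_ij : i j neq_ij eq_f / (i < j)%N.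
  move=> IH; case: (ltngtP i j) => [|lt_ji|/ord_inj eq_ij]; first exact: IH.
    by apply: (IH j i); rewrite // eq_sym.
  by rewrite eq_ij eqxx in neq_ij.
exists i, j; split=> //; have [[y Oy ->] [z Oz ->]] := (Df i, Df j).
exists (z - y); first exact: rpredB.
by rewrite eq_f opprD addrACA subrr add0r mulrBr.
Qed.

(** If m / c is integral, so are all m t^n. Two of them agree modulo m, so t^j - t^i is integral for
    some i < j, which is a monic equation for t. *)
Lemma Oint_completely_closed (c t : K) : c != 0 ->
  (forall n, c * t ^+ n \in Oint K) -> t \in Oint K.
Proof.
move=> c_neq0 Oct.
have [m m_gt0 Om] := Oint_fraction c^-1.
have Omt n : m%:R * t ^+ n \in Oint K.
  by rewrite -[t ^+ n](mulKf c_neq0) mulrA rpredM.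
have [i [j [lt_ij [y Oy]]]] := Oint_pigeonhole m_gt0 Omt.
rewrite -mulrBr => /(mulfI (nat_neq0 K m_gt0)) Dy.
apply: (@Oint_root_monic _ ('X^j - 'X^i - y%:P)).
- rewrite -addrA -opprD monicE lead_coefDl ?lead_coefXn //.
  rewrite size_polyN size_polyXn ltnS (leq_trans (size_polyD _ _)) //.
  by rewrite geq_max size_polyXn lt_ij (leq_trans (size_polyC_leq1 _)) // (leq_trans _ lt_ij).
- by rewrite rootE !hornerE Dy subrr.
- by rewrite !rpredB ?polyOverXn ?polyOverC.
Qed.

End FiniteQuotients.

(** * Ideals of O_K: products, Noetherian induction, primes and their inverses *)

Section Dedekind.
Variable K : fieldExtType rat.
Local Open Scope classical_set_scope.
Local Notation O := (@algebraic_integers K).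
Implicit Types (I J A B D P Q M : set K) (x y z t : K).

Lemma O_Oint x : O x -> x \in Oint K. Proof. by move/OintP. Qed.
Lemma Oint_O x : x \in Oint K -> O x. Proof. by move/OintP. Qed.

Lemma O_ideal : is_ideal O O.
Proof.
split=> // [|x y|x y]; first by apply/Oint_O; exact: rpred0.
  by move=> /O_Oint Ox /O_Oint Oy; apply/Oint_O/rpredD.
by move=> /O_Oint Ox /O_Oint Oy; apply/Oint_O/rpredM.
Qed.

Lemma O1 : O 1. Proof. by apply/Oint_O; exact: rpred1. Qed.
Lemma OM x y : O x -> O y -> O (x * y). Proof. exact: (ideal_mul O_ideal). Qed.
Lemma OD x y : O x -> O y -> O (x + y). Proof. exact: (ideal_add O_ideal). Qed.
Lemma ON x : O x -> O (- x).
Proof. by move=> /O_Oint Ox; apply/Oint_O; rewrite rpredN. Qed.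
Lemma O_nat n : O n%:R. Proof. by apply/Oint_O; exact: rpred_nat. Qed.
Lemma O_exp x n : O x -> O (x ^+ n).
Proof. by move=> /O_Oint Ox; apply/Oint_O/rpredX. Qed.

Lemma ideal0 I : is_ideal O I -> I 0. Proof. by case. Qed.
Lemma idealD I x y : is_ideal O I -> I x -> I y -> I (x + y).
Proof. by case=> _ _ h _; apply: h. Qed.
Lemma idealM I x y : is_ideal O I -> O x -> I y -> I (x * y).
Proof. by case=> _ _ _ h; apply: h. Qed.

Lemma ideal_mulr I x y : is_ideal O I -> I x -> O y -> I (x * y).
Proof. by move=> idI Ix Oy; rewrite mulrC; apply: idealM. Qed.

Lemma ideal_opp I x : is_ideal O I -> I x -> I (- x).
Proof. by move=> idI Ix; rewrite -mulN1r; apply: idealM => //; exact/ON/O1. Qed.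

Lemma ideal_sub_closed I x y : is_ideal O I -> I x -> I y -> I (x - y).
Proof. by move=> idI Ix Iy; apply: idealD => //; apply: ideal_opp. Qed.

Lemma ideal_one I : is_ideal O I -> I 1 -> I = O.
Proof.
move=> idI I1; apply/seteqP; split; first exact: ideal_sub.
by move=> x Ox; rewrite -[x]mulr1; apply: idealM.
Qed.

Lemma mul_ideal_mem I J x y : I x -> J y -> mul_ideal I J (x * y).
Proof.
by move=> Ix Jy; exists [:: (x, y)]; [move=> u /[1!inE]/eqP-> | rewrite big_seq1].
Qed.

Lemma mul_ideal_ind I J A : A 0 -> (forall x y, A x -> A y -> A (x + y)) ->
  (forall x y, I x -> J y -> A (x * y)) -> mul_ideal I J `<=` A.
Proof.
move=> A0 AD AM _ [s sIJ ->]; elim: s sIJ => [|u s IHs] sIJ; first by rewrite big_nil.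
rewrite big_cons; apply: AD; last by apply: IHs => v sv; apply: sIJ; rewrite inE sv orbT.
by have [|Iu Ju] := sIJ u; [rewrite mem_head | apply: AM].
Qed.

Lemma mul_ideal_ideal I J : is_ideal O I -> is_ideal O J -> is_ideal O (mul_ideal I J).
Proof.
move=> idI idJ; split.
- apply: mul_ideal_ind; [exact: ideal0 O_ideal | exact: OD | move=> x y Ix Jy].
  by apply: OM; [apply: (ideal_sub idI) | apply: (ideal_sub idJ)].
- by exists [::]; rewrite ?big_nil.
- move=> _ _ [s1 h1 ->] [s2 h2 ->]; exists (s1 ++ s2); last by rewrite big_cat.
  by move=> u; rewrite mem_cat => /orP[/h1|/h2].
- move=> r _ Or [s h ->]; exists [seq (r * u.1, u.2) | u <- s].
    by move=> _ /mapP[u /h[Iu Ju] ->]; split=> //; apply: idealM.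
  by rewrite big_map mulr_sumr; apply: eq_bigr => u _; rewrite mulrA.
Qed.

Lemma mul_ideal_sub I J A : is_ideal O A ->
  (forall x y, I x -> J y -> A (x * y)) -> mul_ideal I J `<=` A.
Proof.
by move=> idA; apply: mul_ideal_ind; [exact: ideal0 idA | move=> x y; exact: idealD].
Qed.

Lemma mul_idealS I J A B : I `<=` A -> J `<=` B -> mul_ideal I J `<=` mul_ideal A B.
Proof. by move=> IA JB _ [s h ->]; exists s => // u /h[/IA ? /JB]. Qed.

Lemma mul_idealC I J : mul_ideal I J = mul_ideal J I.
Proof.
have sub A B : mul_ideal A B `<=` mul_ideal B A.
  move=> _ [s h ->]; exists [seq (u.2, u.1) | u <- s].
    by move=> _ /mapP[u /h[? ?] ->].
  by rewrite big_map; apply: eq_bigr => u _; rewrite mulrC.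
by apply/seteqP; split; apply: sub.
Qed.

Lemma mul_idealA I J A : is_ideal O I -> is_ideal O J -> is_ideal O A ->
  mul_ideal I (mul_ideal J A) = mul_ideal (mul_ideal I J) A.
Proof.
have sub I' J' A' : is_ideal O I' -> is_ideal O J' -> is_ideal O A' ->
    mul_ideal I' (mul_ideal J' A') `<=` mul_ideal (mul_ideal I' J') A'.
  move=> idI idJ idA; have idP := mul_ideal_ideal (mul_ideal_ideal idI idJ) idA.
  apply: mul_ideal_sub => // x y Ix; move: y; apply: mul_ideal_ind.
  - by rewrite mulr0; apply: ideal0 idP.
  - by move=> y z h1 h2; rewrite mulrDr; apply: idealD.
  - by move=> y z Jy Az; rewrite mulrA; do 2?apply: mul_ideal_mem.
move=> idI idJ idA; apply/seteqP; split; first exact: sub.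
rewrite [mul_ideal I J]mul_idealC mul_idealC [mul_ideal I _]mul_idealC.
by rewrite [mul_ideal J A]mul_idealC; apply: sub.
Qed.

Lemma mul_idealO I : is_ideal O I -> mul_ideal I O = I.
Proof.
move=> idI; apply/seteqP; split.
  by apply: mul_ideal_sub => // x y Ix Oy; apply: ideal_mulr.
by move=> x Ix; rewrite -[x]mulr1; apply: mul_ideal_mem => //; exact: O1.
Qed.

Lemma mul_idealSl I J : is_ideal O I -> is_ideal O J -> mul_ideal I J `<=` I.
Proof.
move=> idI idJ; apply: mul_ideal_sub => // x y Ix Jy.
by apply: ideal_mulr => //; apply: (ideal_sub idJ).
Qed.

Definition nzideal I := is_ideal O I /\ exists2 x, I x & x != 0.

Lemma nzidealO : nzideal O.
Proof. by split; [exact: O_ideal | exists 1; [exact: O1 | exact: oner_neq0]]. Qed.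

Lemma nzideal_mul I J : nzideal I -> nzideal J -> nzideal (mul_ideal I J).
Proof.
move=> [idI [x Ix x0]] [idJ [y Jy y0]]; split; first exact: mul_ideal_ideal.
by exists (x * y); [apply: mul_ideal_mem | rewrite mulf_neq0].
Qed.

Lemma nzidealS I J : nzideal I -> is_ideal O J -> I `<=` J -> nzideal J.
Proof. by move=> [idI [x Ix x0]] idJ IJ; split=> //; exists x => //; apply: IJ. Qed.

Lemma prime_nzideal P : is_prime_ideal O P -> nzideal P.
Proof. by case. Qed.

Lemma principal_ideal_ideal x : O x -> is_ideal O (principal_ideal O x).
Proof.
move=> Ox; split.
- by move=> _ [r Or <-]; apply: OM.
- by exists 0; rewrite ?mulr0 //; apply: ideal0 O_ideal.
- by move=> _ _ [r Or <-] [s Os <-]; exists (r + s); rewrite ?mulrDr //; apply: OD.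
- by move=> r _ Or [s Os <-]; exists (r * s); rewrite 1?mulrCA //; apply: OM.
Qed.

Lemma principal_mem x : principal_ideal O x x.
Proof. by exists 1; [exact: O1 | rewrite mulr1]. Qed.

Lemma nzideal_principal x : O x -> x != 0 -> nzideal (principal_ideal O x).
Proof.
move=> Ox x0; split; first exact: principal_ideal_ideal.
by exists x => //; exact: principal_mem.
Qed.

Lemma principal_sub x I : is_ideal O I -> I x -> principal_ideal O x `<=` I.
Proof. by move=> idI Ix _ [r Or <-]; apply: ideal_mulr. Qed.

Lemma mul_principal x y : O x -> O y ->
  mul_ideal (principal_ideal O x) (principal_ideal O y) = principal_ideal O (x * y).
Proof.
move=> Ox Oy; apply/seteqP; split.
  apply: mul_ideal_sub => [|_ _ [r Or <-] [s Os <-]].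
    exact/principal_ideal_ideal/OM.
  by exists (r * s); [apply: OM | rewrite mulrACA].
apply: principal_sub; first by apply: mul_ideal_ideal; apply: principal_ideal_ideal.
by apply: mul_ideal_mem; apply: principal_mem.
Qed.

Lemma nzideal_nat I : nzideal I -> exists2 n : nat, (0 < n)%N & I n%:R.
Proof.
move=> [idI [x Ix x0]]; have [m m_gt0 Om] := Oint_fraction x^-1.
by exists m => //; rewrite -[m%:R](divfK x0); apply: idealM => //; exact/Oint_O.
Qed.

(** An ideal containing n is a union of classes modulo n, so counting the representatives in it
    gives a bounded measure that increases strictly. It serves for Noetherian induction and for
    bounding exponents of primes. *)
Lemma ideal_count (n : nat) : (0 < n)%N -> exists (c : set K -> nat) (B : nat),
  (forall I, (c I <= B)%N) /\
  forall I J, is_ideal O I -> is_ideal O J -> I n%:R -> I `<=` J -> ~ J `<=` I ->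
    (c I < c J)%N.
Proof.
move=> n_gt0; have [s Os reps] := Oint_reps K n_gt0.
exists (fun I => count (fun r => `[< I r >]) s), (size s); split=> [I|].
  exact: count_size.
move=> I J idI idJ In IJ /nonsubset [x [Jx nIx]].
have [r sr [y /OintP Oy Dx]] := reps x (O_Oint (ideal_sub idJ Jx)).
have Iny : I (n%:R * y) by apply: ideal_mulr.
have Dr : r = x - n%:R * y by rewrite Dx addrK.
have Jr : J r by rewrite Dr; apply: ideal_sub_closed => //; apply: IJ.
have nIr : ~ I r by move=> Ir; apply: nIx; rewrite Dx; apply: idealD.
elim: s sr {Os reps} => //= r' s IHs; rewrite inE => /predU1P[<-|/IHs lt_s].
  rewrite (asboolT Jr) (asboolF nIr) ltnS; apply: sub_count => z /asboolP Iz.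
  by apply/asboolP/IJ.
apply: leq_ltn_trans (_ : _ <= `[< J r' >] + count (fun r => `[< I r >]) s)%N _.
  by rewrite leq_add2r; case: asboolP => // /IJ /asboolT ->.
by rewrite ltn_add2l.
Qed.

Lemma ideal_noetherian_ind (T : set K -> Prop) :
  (forall I, nzideal I -> (forall J, nzideal J -> I `<=` J -> ~ J `<=` I -> T J) -> T I) ->
  forall I, nzideal I -> T I.
Proof.
move=> IH I0 nzI0; have [n n_gt0 I0n] := nzideal_nat nzI0.
have [c [b [cb c_lt]]] := ideal_count n_gt0.
suff main m I : nzideal I -> I n%:R -> (b - c I < m)%N -> T I.
  exact: (main (b - c I0).+1).
elim: m I => // m IHm I nzI In; rewrite ltnS => le_m.
apply: IH => // J nzJ IJ nJI; apply: IHm => //; first exact: IJ.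
have lt_c : (c I < c J)%N by apply: c_lt => //; [case: nzI | case: nzJ].
by apply: leq_trans le_m; rewrite ltn_sub2l // (leq_trans lt_c).
Qed.

(** If I is not prime, some x y lies in I with x and y outside. The ideal I + x O_K is larger, and
    proper because 1 = i + x r would give y = i y + x y r in I. *)
Lemma ideal_sub_prime I : nzideal I -> ~ I 1 -> exists2 P, is_prime_ideal O P & I `<=` P.
Proof.
move: I; apply: ideal_noetherian_ind => I nzI IH nI1; have [idI exI] := nzI.
have [prI|nprI] := pselect (is_prime_ideal O I); first by exists I.
have [x [y [Ox Oy Ixy nIx nIy]]] :
    exists x y, [/\ O x, O y, I (x * y), ~ I x & ~ I y].
  apply: contrapT => no_xy; apply: nprI; split=> // x y Ox Oy Ixy.
  by apply: contrapT => /not_orP[nIx nIy]; apply: no_xy; exists x, y.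
pose J := [set z | exists2 i, I i & exists2 r, O r & z = i + x * r].
have idJ : is_ideal O J.
  split.
  - by move=> _ [i Ii [r Or ->]]; apply: OD; [apply: ideal_sub Ii | apply: OM].
  - exists 0; first exact: ideal0.
    by exists 0; rewrite ?mulr0 ?addr0 //; exact: ideal0 O_ideal.
  - move=> _ _ [i Ii [r Or ->]] [i' Ii' [r' Or' ->]]; exists (i + i').
      exact: idealD.
    by exists (r + r'); [apply: OD | rewrite mulrDr addrACA].
  - move=> a _ Oa [i Ii [r Or ->]]; exists (a * i); first exact: idealM.
    by exists (a * r); [apply: OM | rewrite mulrDr mulrCA].
have IJ : I `<=` J.
  move=> i Ii; exists i => //; exists 0; first exact: ideal0 O_ideal.
  by rewrite mulr0 addr0.
have nJI : ~ J `<=` I.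
  move=> JI; apply/nIx/JI; exists 0; first exact: ideal0.
  by exists 1; [exact: O1 | rewrite mulr1 add0r].
have nJ1 : ~ J 1.
  move=> [i Ii [r Or D1]]; apply: nIy; rewrite -[y]mul1r D1 mulrDl.
  apply: idealD => //; first exact: ideal_mulr.
  by rewrite mulrAC; apply: ideal_mulr.
have [P prP JP] := IH J (nzidealS nzI idJ IJ) IJ nJI nJ1.
by exists P => //; apply: subset_trans JP.
Qed.

Lemma prime_ideal_exp P x n : is_prime_ideal O P -> O x -> P (x ^+ n) -> P x.
Proof.
move=> prP Ox; elim: n => [|n IHn]; first by move/(prime_ideal_proper prP).
by rewrite exprS => /(prime_ideal_mul prP Ox (O_exp n Ox))[|/IHn].
Qed.

(** O_K / P is a finite domain: two powers of x agree modulo an integer of P, and cancelling x^i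
    leaves the inverse x^(j-i-1). *)
Lemma prime_ideal_maximal P x : is_prime_ideal O P -> O x -> ~ P x ->
  exists2 r, O r & P (1 - x * r).
Proof.
move=> prP Ox nPx; have [n n_gt0 Pn] := nzideal_nat (prime_nzideal prP).
have [i [j [lt_ij [y /OintP Oy Dy]]]] :=
  Oint_pigeonhole n_gt0 (fun k => O_Oint (O_exp k Ox)).
have Oxx : O (x ^+ (j - i) - 1).
  by apply: OD; [apply: O_exp | apply/ON/O1].
have: P (x ^+ i * (x ^+ (j - i) - 1)).
  rewrite mulrBr mulr1 -exprD subnKC; last exact: ltnW.
  by rewrite Dy; apply: ideal_mulr => //; apply: prime_ideal_ideal.
case/(prime_ideal_mul prP (O_exp i Ox) Oxx) => [/(prime_ideal_exp prP Ox) //|Pxx].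
exists (x ^+ (j - i).-1); first exact: O_exp.
rewrite -exprS prednK ?subn_gt0 // -opprB.
by apply: ideal_opp => //; apply: prime_ideal_ideal.
Qed.

Lemma prime_ideal_sub_eq P Q : is_prime_ideal O P -> is_prime_ideal O Q ->
  P `<=` Q -> P = Q.
Proof.
move=> prP prQ PQ; apply/seteqP; split=> // x Qx; apply: contrapT => nPx.
have idQ := prime_ideal_ideal prQ.
have Ox := ideal_sub idQ Qx.
have [r Or /PQ Q1] := prime_ideal_maximal prP Ox nPx.
apply: (prime_ideal_proper prQ); rewrite -[1](subrK (x * r)).
by apply: idealD => //; apply: ideal_mulr.
Qed.

(* Among the ideals (a : b) contained in P with b not in (a), a maximal one is
   prime, hence equal to P, and then b / a is the required element. *)
Lemma prime_ideal_inverse P : is_prime_ideal O P ->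
  exists2 t, ~ O t & forall x, P x -> O (t * x).
Proof.
move=> prP; have idP := prime_ideal_ideal prP; have [a Pa a0] := prime_ideal_nonzero prP.
have Oa := ideal_sub idP Pa; pose aO := principal_ideal O a.
have idaO : is_ideal O aO := principal_ideal_ideal Oa.
pose colon b := [set x | O x /\ aO (x * b)].
have colonS b c : O b -> O c -> colon b `<=` colon (b * c).
  by move=> Ob Oc x [Ox axb]; split=> //; rewrite mulrA; apply: ideal_mulr.
have id_colon b : O b -> is_ideal O (colon b).
  move=> Ob; split; first by move=> x [].
  - by split; [exact: ideal0 O_ideal | rewrite mul0r; exact: ideal0 idaO].
  - move=> x y [Ox ax] [Oy ay]; split; first exact: OD.
    by rewrite mulrDl; apply: idealD.
  - move=> r x Or [Ox ax]; split; first exact: OM.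
    by rewrite -mulrA; apply: idealM.
have a_colon b : O b -> colon b a by move=> Ob; split=> //; exists b.
have nz_colon b : O b -> nzideal (colon b).
  by move=> Ob; split; [exact: id_colon | exists a => //; exact: a_colon].
suff [b [Ob nab Pb]] : exists b, [/\ O b, ~ aO b & P `<=` colon b].
  exists (b / a).
    by move=> Oba; apply: nab; exists (b / a) => //; rewrite mulrC divfK.
  by move=> x /Pb[Ox [r Or Dr]]; rewrite mulrAC [b * x]mulrC -Dr mulrAC divff // mul1r.
pose T I := forall b, O b -> ~ aO b -> I = colon b -> I `<=` P ->
  exists b, [/\ O b, ~ aO b & P `<=` colon b].
have TT : forall I, nzideal I -> T I.
  apply: ideal_noetherian_ind => I nzI IH b Ob nab DI IP; subst I.
  have [pr|npr] := pselect (is_prime_ideal O (colon b)).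
    by exists b; split=> //; rewrite (prime_ideal_sub_eq pr prP IP).
  have [x [y [Ox Oy Ixy nIx nIy]]] :
      exists x y, [/\ O x, O y, colon b (x * y), ~ colon b x & ~ colon b y].
    apply: contrapT => no_xy; apply: npr; split; first exact: id_colon.
    - by move=> /IP /(prime_ideal_proper prP).
    - by case: nzI.
    move=> x y Ox Oy Ixy; apply: contrapT => /not_orP[nIx nIy].
    by apply: no_xy; exists x, y.
  have nabx : ~ aO (b * x) by move=> abx; apply: nIx; split=> //; rewrite mulrC.
  (* Either (a : b x), which contains y, is a larger ideal inside P, or it contains some s outside
     P. Then (a : b s) contains x, and it lies in P since z s in (a : b) forces z into P. *)
  have [xP|/nonsubset [s [[Os sbx] nPs]]] := pselect (colon (b * x) `<=` P).
    apply: (IH (colon (b * x)) (nz_colon _ (OM Ob Ox)) _ _ (b * x)) => //.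
    - exact: colonS.
    - move=> sub; apply/nIy/sub; split=> //.
      by case: Ixy => _; rewrite (_ : y * (b * x) = x * y * b) //; ring.
    - exact: OM.
  apply: (IH (colon (b * s)) (nz_colon _ (OM Ob Os)) _ _ (b * s)) => //.
  - exact: colonS.
  - move=> sub; apply/nIx/sub; split=> //.
    by rewrite (_ : x * (b * s) = s * (b * x)) //; ring.
  - exact: OM.
  - by move=> abs; apply/nPs/IP; split=> //; rewrite mulrC.
  - move=> z [Oz azbs]; have: colon b (z * s).
      by split; [exact: OM | rewrite -mulrA [s * b]mulrC].
    by move/IP/(prime_ideal_mul prP Oz Os) => [|/nPs].
apply: (TT (colon 1) (nz_colon _ O1) 1) => //; first exact: O1.
  by move=> /(principal_sub idP Pa) /(prime_ideal_proper prP).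
by move=> x [Ox]; rewrite mulr1 => /(principal_sub idP Pa).
Qed.

End Dedekind.

(** * Invertibility of ideals, valuations and the associated ideals *)

Section Factorization.
Variable K : fieldExtType rat.
Local Open Scope classical_set_scope.
Local Notation O := (@algebraic_integers K).
Implicit Types (I J A B D P Q M : set K) (x y z t : K).

(* With D = m I^-1, the ideal J = I I^-1 satisfies J^-1 = O by complete integral
   closedness, so it lies in no prime ideal. *)
Lemma ideal_invertible I : nzideal I -> exists D m,
  [/\ is_ideal O D, O m, m != 0 & mul_ideal I D = principal_ideal O m].
Proof.
move=> [idI [m Im m0]]; have Om := ideal_sub idI Im.
have idmO := principal_ideal_ideal Om.
pose D := [set x | O x /\ forall y, I y -> principal_ideal O m (x * y)].
have idD : is_ideal O D.
  split; first by move=> x [].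
  - split; first exact: ideal0 (O_ideal K).
    by move=> y _; rewrite mul0r; exact: ideal0.
  - move=> x x' [Ox Dx] [Ox' Dx']; split=> [|y Iy]; first exact: OD.
    by rewrite mulrDl; apply: idealD => //; [apply: Dx | apply: Dx'].
  - move=> r x Or [Ox Dx]; split=> [|y Iy]; first exact: OM.
    by rewrite -mulrA; apply: idealM => //; apply: Dx.
have IDm : mul_ideal I D `<=` principal_ideal O m.
  by apply: mul_ideal_sub => // x y Ix [_ Dy]; rewrite mulrC; apply: Dy.
have Dm : D m.
  by split=> // y Iy; exists y => //; apply: ideal_sub Iy.
exists D, m; split=> //; apply/seteqP; split=> //.
have idID := mul_ideal_ideal idI idD.
pose J := [set z | O z /\ mul_ideal I D (m * z)].
have idJ : is_ideal O J.
  split; first by move=> z [].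
  - by split; [exact: ideal0 (O_ideal K) | rewrite mulr0; exact: ideal0].
  - move=> x y [Ox Jx] [Oy Jy]; split; first exact: OD.
    by rewrite mulrDr; apply: idealD.
  - move=> r x Or [Ox Jx]; split; first exact: OM.
    by rewrite mulrCA; apply: idealM.
have nzJ : nzideal J.
  by split=> //; exists m => //; split=> //; apply: mul_ideal_mem.
apply: principal_sub => //.
suff [_] : J 1 by rewrite mulr1.
apply: contrapT => /(ideal_sub_prime nzJ)[P prP JP].
have [t nOt tP] := prime_ideal_inverse prP.
(* For y in I write d y = m z. Then z lies in J, hence in P, so t z is integral and t d y is in m
   O_K. *)
have tD d : D d -> D (t * d).
  move=> Dd; have tdI y : I y -> principal_ideal O m (t * d * y).
    move=> Iy; have [z Oz Dz] : principal_ideal O m (d * y) by case: Dd => _; apply.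
    exists (t * z); last by rewrite mulrCA Dz mulrA.
    by apply/tP/JP; split=> //; rewrite Dz mulrC; apply: mul_ideal_mem.
  split=> //; have [z Oz Dz] := tdI m Im.
  by rewrite (_ : t * d = z) //; apply: (mulIf m0); rewrite -Dz mulrC.
apply/nOt/OintP/(Oint_completely_closed m0) => n; apply/OintP.
suff [] : D (m * t ^+ n) by [].
elim: n => [|n IHn]; first by rewrite mulr1.
by rewrite exprS mulrCA; apply: tD.
Qed.

Lemma mul_ideal_cancel I A B : nzideal I -> is_ideal O A -> is_ideal O B ->
  mul_ideal I A `<=` mul_ideal I B -> A `<=` B.
Proof.
move=> nzI idA idB IAB; have [idI _] := nzI.
have [D [m [idD Om m0 DIm]]] := ideal_invertible nzI.
have mB y : mul_ideal (principal_ideal O m) B (m * y) -> B y.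
  suff sub : mul_ideal (principal_ideal O m) B `<=` [set z | exists2 b, B b & z = m * b].
    by move=> /sub[b Bb /(mulfI m0) ->].
  apply: mul_ideal_ind.
  - by exists 0; [exact: ideal0 | rewrite mulr0].
  - by move=> _ _ [b Bb ->] [c Bc ->]; exists (b + c); [apply: idealD | rewrite mulrDr].
  - by move=> _ b [r Or <-] Bb; exists (r * b); [apply: idealM | rewrite mulrA].
move=> y Ay; apply: mB; rewrite -DIm [mul_ideal I D]mul_idealC -mul_idealA //.
apply: (mul_idealS (fun _ h => h) IAB); rewrite mul_idealA // [mul_ideal D I]mul_idealC DIm.
by apply: mul_ideal_mem => //; exact: principal_mem.
Qed.

(** To contain is to divide: the quotient is I^-1 J, built as m^-1 D J where I D = m O_K. *)
Lemma dvd_idealP I J : nzideal I -> is_ideal O J -> dvd_ideal O I J <-> J `<=` I.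
Proof.
move=> nzI idJ; have [idI _] := nzI; split.
  by move=> [D idD ->]; apply: mul_idealSl.
move=> JI; have [D [m [idD Om m0 DIm]]] := ideal_invertible nzI.
have idDJ := mul_ideal_ideal idD idJ.
pose C := [set x | O x /\ mul_ideal D J (m * x)].
exists C.
  split; first by move=> x [].
  - by split; [exact: ideal0 (O_ideal K) | rewrite mulr0; exact: ideal0].
  - move=> x y [Ox Cx] [Oy Cy]; split; first exact: OD.
    by rewrite mulrDr; apply: idealD.
  - move=> r x Or [Ox Cx]; split; first exact: OM.
    by rewrite mulrCA; apply: idealM.
apply/seteqP; split=> [j Jj|].
  have [s sID Dm] : mul_ideal I D m by rewrite DIm; exact: principal_mem.
  exists [seq (u.1, u.2 * j / m) | u <- s].
    move=> _ /mapP[u /sID[Iu Du] ->] /=; split=> //.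
    have [z Oz Dz] : principal_ideal O m (u.2 * j).
      by rewrite -DIm mulrC; apply: mul_ideal_mem => //; apply: JI.
    rewrite -Dz mulrAC divff // mul1r; split=> //.
    by rewrite Dz; apply: mul_ideal_mem.
  rewrite big_map /=; under eq_bigr do rewrite !mulrA.
  by rewrite -!mulr_suml -Dm mulrAC divff // mul1r.
apply: mul_ideal_sub => // x y Ix [Oy Cy].
have sub : mul_ideal D J `<=` [set w | exists2 j, J j & x * w = m * j].
  apply: mul_ideal_ind.
  - by exists 0; rewrite ?mulr0 //; exact: ideal0.
  - move=> a b [j Jj aj] [j' Jj' bj]; exists (j + j'); first exact: idealD.
    by rewrite !mulrDr aj bj.
  - move=> d j Dd Jj; have [r Or Dr] : principal_ideal O m (x * d).
      by rewrite -DIm; apply: mul_ideal_mem.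
    by exists (r * j); [apply: idealM | rewrite !mulrA Dr].
have [j Jj] := sub _ Cy; rewrite mulrCA => /(mulfI m0) ->; exact: Jj.
Qed.

(** The premise says that the inverse of I is contained in that of J. With I D = m O_K, every d / m
    lies in the inverse of I, so D J is inside m O_K = D I, and D cancels. *)
Lemma ideal_inverse_sub I J : nzideal I -> is_ideal O J ->
  (forall k, (forall x, I x -> O (k * x)) -> forall x, J x -> O (k * x)) -> J `<=` I.
Proof.
move=> nzI idJ invIJ; have [idI _] := nzI.
have [D [m [idD Om m0 DIm]]] := ideal_invertible nzI.
have nzD : nzideal D.
  split=> //; apply: contrapT => no_D; suff: mul_ideal I D `<=` [set 0].
    by rewrite DIm => /(_ m (principal_mem m)) /eqP; apply/negP.
  apply: mul_ideal_ind => //= [x y -> ->|x y _ Dy]; first by rewrite addr0.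
  have [->|y0] := eqVneq y 0; first by rewrite mulr0.
  by case: no_D; exists y.
apply: (mul_ideal_cancel nzD idJ idI); rewrite [mul_ideal D I]mul_idealC DIm.
apply: mul_ideal_sub; first exact: principal_ideal_ideal.
move=> d x Dd Jx; exists (d / m * x); last by rewrite mulrA [m * _]mulrC divfK.
apply: invIJ => // y Iy; have [r Or Dr] : principal_ideal O m (y * d).
  by rewrite -DIm; apply: mul_ideal_mem.
by rewrite mulrAC [d * y]mulrC -Dr mulrAC divff ?mul1r.
Qed.

Lemma exp_ideal_nz P n : nzideal P -> nzideal (exp_ideal O P n).
Proof.
move=> nzP; elim: n => [|n IHn]; first exact: nzidealO.
exact: nzideal_mul.
Qed.

Lemma exp_idealD P m n : nzideal P ->
  exp_ideal O P (m + n) = mul_ideal (exp_ideal O P m) (exp_ideal O P n).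
Proof.
move=> nzP; have [idP _] := nzP; have idX k : is_ideal O (exp_ideal O P k).
  by have [] := exp_ideal_nz k nzP.
elim: m => [|m IHm] /=; first by rewrite mul_idealC mul_idealO.
rewrite -[RHS]mul_idealA //; exact: (congr1 (mul_ideal P) IHm).
Qed.

Lemma exp_idealSl P m n : nzideal P -> (m <= n)%N -> exp_ideal O P n `<=` exp_ideal O P m.
Proof.
move=> nzP le_mn; rewrite -(subnKC le_mn) exp_idealD //.
by apply: mul_idealSl; apply: (proj1 (exp_ideal_nz _ nzP)).
Qed.

Lemma exp_ideal1 P : nzideal P -> exp_ideal O P 1 = P.
Proof. by case=> idP _; rewrite /exp_ideal /= mul_idealO. Qed.

Lemma exp_ideal_strict P n : is_prime_ideal O P ->
  ~ exp_ideal O P n `<=` exp_ideal O P n.+1.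
Proof.
move=> prP; have nzP := prime_nzideal prP; have [idP _] := nzP.
have nzX := exp_ideal_nz n nzP; have [idX _] := nzX.
rewrite -addn1 exp_idealD // exp_ideal1 // -{1}(mul_idealO idX).
by move=> /(mul_ideal_cancel nzX (O_ideal K) idP) /(_ _ (O1 K)) /(prime_ideal_proper prP).
Qed.

(** The definition picks a largest exponent, which has to exist: the powers of P containing I
    decrease strictly and share a positive integer, so [ideal_count] bounds their number. *)
Lemma ideal_val_geP P I n : is_prime_ideal O P -> nzideal I ->
  (n <= ideal_val O P I)%N <-> I `<=` exp_ideal O P n.
Proof.
move=> prP nzI; have nzP := prime_nzideal prP; have [idI _] := nzI.
have [N N_gt0 IN] := nzideal_nat nzI; have [c [b [cb c_lt]]] := ideal_count K N_gt0.
have idX k : is_ideal O (exp_ideal O P k) by have [] := exp_ideal_nz k nzP.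
have bnd k : `[< dvd_ideal O (exp_ideal O P k) I >] -> (k <= b)%N.
  move=> /asboolP /dvd_idealP-/(_ (exp_ideal_nz k nzP) idI) IP.
  apply: leq_trans (cb (exp_ideal O P 0)).
  suff: (k <= c (exp_ideal O P 0) - c (exp_ideal O P k))%N.
    by move=> /leq_trans; apply; exact: leq_subr.
  elim: k IP => // k IHk IP; have IPk := subset_trans IP (exp_idealSl nzP (leqnSn k)).
  have lt_c : (c (exp_ideal O P k.+1) < c (exp_ideal O P k))%N.
    apply: c_lt => //; [exact: IP | exact: exp_idealSl | exact: exp_ideal_strict].
  apply: leq_ltn_trans (IHk IPk) _; rewrite ltn_sub2l //.
  apply: leq_trans lt_c _; have := IHk IPk; case: (k) => // k'.
  by move=> h; rewrite ltnW // -subn_gt0 (leq_trans _ h).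
have ex0 : exists k, `[< dvd_ideal O (exp_ideal O P k) I >].
  by exists 0%N; apply/asboolP/dvd_idealP => //; [exact: nzidealO | exact: ideal_sub idI].
have [v /asboolP dvd_v max_v] := ex_maxnP ex0 bnd.
have [dvdV maxV] : [set n : nat | dvd_ideal O (exp_ideal O P n) I /\
    forall m : nat, dvd_ideal O (exp_ideal O P m) I -> (m <= n)%N] (ideal_val O P I).
  apply: (xgetPex 0%N); exists v; split=> // m dvd_m; exact/max_v/asboolP.
split=> [le_n|IPn].
  apply: subset_trans (exp_idealSl nzP le_n).
  exact/(dvd_idealP (exp_ideal_nz _ nzP) idI).
by apply/maxV/dvd_idealP => //; exact: exp_ideal_nz.
Qed.

Lemma ideal_val_factor P I : is_prime_ideal O P -> nzideal I ->
  exists J, [/\ nzideal J, ~ J `<=` P & I = mul_ideal (exp_ideal O P (ideal_val O P I)) J].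
Proof.
move=> prP nzI; have nzP := prime_nzideal prP; have [idI exI] := nzI.
set v := ideal_val O P I; have nzX := exp_ideal_nz v nzP; have [idX _] := nzX.
have /(dvd_idealP nzX idI)[J idJ DI] : I `<=` exp_ideal O P v.
  by apply/(ideal_val_geP _ prP nzI).
have JI : I `<=` J by rewrite DI mul_idealC; apply: mul_idealSl.
exists J; split=> //; first exact: nzidealS JI.
move=> JP; suff: (v.+1 <= v)%N by rewrite ltnn.
apply/(ideal_val_geP _ prP nzI); rewrite -addn1 exp_idealD // exp_ideal1 // DI.
exact: mul_idealS.
Qed.

Lemma ideal_val_unique P I J n : is_prime_ideal O P -> nzideal J -> ~ J `<=` P ->
  I = mul_ideal (exp_ideal O P n) J -> ideal_val O P I = n.
Proof.
move=> prP nzJ nJP DI; have nzP := prime_nzideal prP; have [idP _] := nzP.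
have nzX := exp_ideal_nz n nzP; have [idX _] := nzX; have [idJ _] := nzJ.
have nzI : nzideal I by rewrite DI; exact: nzideal_mul.
apply/eqP; rewrite eqn_leq leqNgt; apply/andP; split.
  apply/negP => /(ideal_val_geP _ prP nzI).
  rewrite -addn1 exp_idealD // exp_ideal1 // DI => /(mul_ideal_cancel nzX idJ idP).
  exact: nJP.
by apply/(ideal_val_geP _ prP nzI); rewrite DI; apply: mul_idealSl.
Qed.

(** Since P is prime, the product of two cofactors not contained in P is not contained in P. *)
Lemma ideal_valM P I J : is_prime_ideal O P -> nzideal I -> nzideal J ->
  ideal_val O P (mul_ideal I J) = (ideal_val O P I + ideal_val O P J)%N.
Proof.
move=> prP nzI nzJ; have nzP := prime_nzideal prP.
have [I' [nzI' nI'P DI]] := ideal_val_factor prP nzI.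
have [J' [nzJ' nJ'P DJ]] := ideal_val_factor prP nzJ.
have [[idI' _] [idJ' _]] := (nzI', nzJ').
have idX k : is_ideal O (exp_ideal O P k) by have [] := exp_ideal_nz k nzP.
apply: (@ideal_val_unique _ _ (mul_ideal I' J')) => //; first exact: nzideal_mul.
  move: nI'P nJ'P => /nonsubset [x [I'x nPx]] /nonsubset [y [J'y nPy]] sub.
  have := sub _ (mul_ideal_mem I'x J'y).
  have [Ox Oy] := (ideal_sub idI' I'x, ideal_sub idJ' J'y).
  by move=> /(prime_ideal_mul prP Ox Oy)[/nPx|/nPy].
rewrite {1}DI {1}DJ exp_idealD //.
set A := exp_ideal _ _ _; set B := exp_ideal _ _ _.
have [idA idB] : is_ideal O A /\ is_ideal O B by split; exact: idX.
rewrite -!mul_idealA //; try exact: mul_ideal_ideal.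
congr (mul_ideal A _); rewrite !mul_idealA //.
by rewrite [mul_ideal I' B]mul_idealC.
Qed.

Lemma ideal_val_O P : is_prime_ideal O P -> ideal_val O P O = 0%N.
Proof.
move=> prP; apply: (@ideal_val_unique _ _ O) => //; first exact: nzidealO.
  by move=> /(_ _ (O1 K)) /(prime_ideal_proper prP).
by rewrite [RHS]mul_idealO //; exact: O_ideal.
Qed.

Lemma ideal_val_self P : is_prime_ideal O P -> ideal_val O P P = 1%N.
Proof.
move=> prP; have nzP := prime_nzideal prP; have [idP _] := nzP.
apply: (@ideal_val_unique _ _ O) => //; first exact: nzidealO.
  by move=> /(_ _ (O1 K)) /(prime_ideal_proper prP).
by rewrite exp_ideal1 // mul_idealO.
Qed.

Lemma ideal_val_other P Q : is_prime_ideal O P -> is_prime_ideal O Q -> P <> Q ->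
  ideal_val O Q P = 0%N.
Proof.
move=> prP prQ neqPQ; have nzP := prime_nzideal prP; have [idP _] := nzP.
apply: (@ideal_val_unique _ _ P) => // [/(prime_ideal_sub_eq prP prQ)//|].
by rewrite [RHS]mul_idealC mul_idealO.
Qed.

Lemma ideal_val_exp P Q n : is_prime_ideal O P -> is_prime_ideal O Q ->
  ideal_val O Q (exp_ideal O P n) = ((P == Q) * n)%N.
Proof.
move=> prP prQ; have nzP := prime_nzideal prP.
elim: n => [|n IHn]; first by rewrite muln0; exact: ideal_val_O.
rewrite -add1n exp_idealD // ideal_valM //; try exact: exp_ideal_nz.
rewrite IHn exp_ideal1 // mulnDr muln1; congr (_ + _)%N.
by case: eqP => [<-|neq]; [exact: ideal_val_self | exact: ideal_val_other].
Qed.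

(** Noetherian induction on J: a prime above J also contains I by the comparison of valuations, and
    cancelling it from both makes J strictly larger. *)
Lemma ideal_val_subP I J : nzideal I -> nzideal J ->
  I `<=` J <-> forall P, is_prime_ideal O P -> (ideal_val O P J <= ideal_val O P I)%N.
Proof.
move=> nzI nzJ; split=> [IJ P prP|].
  by apply/ideal_val_geP => //; apply: (subset_trans IJ); apply/ideal_val_geP.
move: J nzJ I nzI; apply: ideal_noetherian_ind => J nzJ IH I nzI leJI.
have [[idI _] [idJ _]] := (nzI, nzJ).
have [/(ideal_one idJ) ->|nJ1] := pselect (J 1); first exact: ideal_sub idI.
have [P prP JP] := ideal_sub_prime nzJ nJ1; have nzP := prime_nzideal prP.
have [idP _] := nzP.
have IP : I `<=` P.
  rewrite -(exp_ideal1 nzP); apply/ideal_val_geP => //; apply: leq_trans (leJI P prP).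
  by apply/ideal_val_geP => //; rewrite exp_ideal1.
have /(dvd_idealP nzP idI)[I' idI' DI] := IP.
have /(dvd_idealP nzP idJ)[J' idJ' DJ] := JP.
have JJ' : J `<=` J' by rewrite DJ mul_idealC; apply: mul_idealSl.
have II' : I `<=` I' by rewrite DI mul_idealC; apply: mul_idealSl.
have [nzI' nzJ'] := (nzidealS nzI idI' II', nzidealS nzJ idJ' JJ').
rewrite DI DJ; apply: mul_idealS => //; apply: IH => //.
  move=> J'J; apply: (prime_ideal_proper prP).
  apply: (mul_ideal_cancel nzJ' (O_ideal K) idP) (O1 K).
  by rewrite mul_idealO // [mul_ideal J' P]mul_idealC -DJ.
by move=> Q prQ; have := leJI Q prQ; rewrite DI DJ !ideal_valM // leq_add2l.
Qed.

(** An ideal containing n is determined by the representatives modulo n that it contains. *)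
Lemma finite_primes_over I : nzideal I -> finite_set [set P | is_prime_ideal O P /\ I `<=` P].
Proof.
move=> nzI; have [n n_gt0 In] := nzideal_nat nzI; have [s Os reps] := Oint_reps K n_gt0.
pose g (phi : {ffun 'I_(size s) -> bool}) := [set x | O x /\
  exists i : 'I_(size s), phi i /\ exists2 y, O y & x = s`_i + n%:R * y].
apply: (@sub_finite_set _ _ (g @` setT)); last exact/finite_image/finite_finset.
move=> P [prP IP]; have idP := prime_ideal_ideal prP; have Pn := IP _ In.
exists [ffun i : 'I_(size s) => `[< P s`_i >]] => //.
apply/seteqP; split=> x.
  move=> [Ox [i []]]; rewrite ffunE => /asboolP Pi [y Oy ->].
  by apply: idealD => //; apply: ideal_mulr.
move=> Px; have Ox := ideal_sub idP Px; split=> //.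
have [r sr [y /OintP Oy Dx]] := reps x (O_Oint Ox).
have lt_r : (index r s < size s)%N by rewrite index_mem.
exists (Ordinal lt_r); split; last by exists y; rewrite //= nth_index.
rewrite ffunE /= nth_index //; apply/asboolP; rewrite -(addrK (n%:R * y) r) -Dx.
by apply: ideal_sub_closed => //; apply: ideal_mulr.
Qed.

Lemma ideal_val_prod (e : set K -> nat) (s : seq (set K)) :
  uniq s -> (forall P, P \in s -> is_prime_ideal O P) ->
  nzideal (\big[@mul_ideal K/O]_(P <- s) exp_ideal O P (e P)) /\
  forall Q, is_prime_ideal O Q ->
    ideal_val O Q (\big[@mul_ideal K/O]_(P <- s) exp_ideal O P (e P)) =
    ((Q \in s) * e Q)%N.
Proof.
elim: s => [|P s IHs] /=; first by rewrite big_nil; split; [exact: nzidealO | exact: ideal_val_O].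
move=> /andP[nPs uniq_s] pr_s; have prP : is_prime_ideal O P by apply: pr_s; rewrite mem_head.
have [] := IHs uniq_s; first by move=> Q sQ; apply: pr_s; rewrite inE sQ orbT.
rewrite big_cons; set J := \big[_/_]_(_ <- _) _ => nzJ valJ.
have nzX := exp_ideal_nz (e P) (prime_nzideal prP).
split=> [|Q prQ]; first exact: nzideal_mul.
rewrite ideal_valM // valJ // ideal_val_exp // inE [Q == P]eq_sym.
by case: eqP => [<-|_] /=; rewrite ?(negbTE nPs) ?addn0.
Qed.

(** The product over all primes would default to O_K on an infinite support. Here a prime not
    containing I has exponent 0, so [finite_primes_over] makes the support finite. *)
Lemma ideal_val_associated (p j : nat) I : nzideal I ->
  nzideal (associated_ideal O p I j) /\
  forall Q, is_prime_ideal O Q ->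
    ideal_val O Q (associated_ideal O p I j) = ((j * ideal_val O Q I) %/ p)%N.
Proof.
move=> nzI; rewrite /associated_ideal.
pose e P := ((j * ideal_val O P I) %/ p)%N.
set s := finite_support _ _ _.
have fin : finite_set ([set P | is_prime_ideal O P] `&`
    (fun P => exp_ideal O P (e P)) @^-1` [set~ O]).
  apply: sub_finite_set (finite_primes_over nzI) => P [/= prP neqO]; split=> //.
  have nzP := prime_nzideal prP; rewrite -(exp_ideal1 nzP); apply/ideal_val_geP => //.
  by rewrite lt0n; apply/eqP => v0; apply: neqO; rewrite /e v0 muln0 div0n.
have mem_s := in_finite_support fin.
have pr_s P : P \in s -> is_prime_ideal O P by rewrite mem_s inE => -[].
have [nzB valB] := ideal_val_prod e (finite_support_uniq _ _ _ : uniq s) pr_s.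
split=> // Q prQ; rewrite valB //.
have [//|nsQ] := boolP (Q \in s); first by rewrite mul1n.
have : exp_ideal O Q (e Q) = O.
  apply: contrapT => neqO; move/negP: nsQ; apply.
  by rewrite mem_s inE.
by move=> /(congr1 (ideal_val O Q)); rewrite ideal_val_exp // eqxx mul1n ideal_val_O.
Qed.

Lemma ideal_val_principalX P x n : is_prime_ideal O P -> O x -> x != 0 ->
  ideal_val O P (principal_ideal O (x ^+ n)) = (n * ideal_val O P (principal_ideal O x))%N.
Proof.
move=> prP Ox x0; elim: n => [|n IHn].
  have -> : principal_ideal O (x ^+ 0) = O.
    by apply: ideal_one; [exact/principal_ideal_ideal/O1 | exact: principal_mem].
  exact: ideal_val_O.
have Oxn := O_exp n Ox.
rewrite exprS -mul_principal // ideal_valM ?IHn ?mulSn //; apply: nzideal_principal => //.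
by rewrite expf_neq0.
Qed.

(** Prime by prime, p v(k) + j v(b) >= 0 amounts to v(k) + floor(j v(b) / p) >= 0, because v(k) is
    an integer. When beta^p = b, the left side expresses integrality of k beta^j. *)
Lemma associated_inverse (p j : nat) b k : (0 < p)%N -> O b -> b != 0 ->
  O (k ^+ p * b ^+ j) <->
  forall x, associated_ideal O p (principal_ideal O b) j x -> O (k * x).
Proof.
move=> p_gt0 Ob b0; have nzb := nzideal_principal Ob b0.
have [nzB valB] := ideal_val_associated p j nzb; have [idB _] := nzB.
set B := associated_ideal _ _ _ _ in nzB valB idB *.
have [->|k0] := eqVneq k 0.
  rewrite expr0n eqn0Ngt p_gt0 mul0r; split=> [_ x _|_]; last exact: (O_nat K 0).
  by rewrite mul0r; exact: (O_nat K 0).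
(* Valuations are available for ideals of O_K only, so k is written as y / n and the denominator is
   moved across. *)
have [n n_gt0 /OintP] := Oint_fraction k; set y := n%:R * k => Oy.
have n0 := nat_neq0 K n_gt0; have On := O_nat K n.
have y0 : y != 0 by rewrite mulf_neq0.
have Dk : k = y / n%:R by rewrite /y mulrAC divff ?mul1r.
have nzn := nzideal_principal On n0; have nzy := nzideal_principal Oy y0.
have Oyb : O (y ^+ p * b ^+ j) by apply: OM; apply: O_exp.
have yb0 : y ^+ p * b ^+ j != 0 by rewrite mulf_neq0 ?expf_neq0.
have np0 : n%:R ^+ p != 0 :> K by rewrite expf_neq0.
have nznp := nzideal_principal (O_exp p On) np0.
have nzyb := nzideal_principal Oyb yb0.
have -> : O (k ^+ p * b ^+ j) <->
    principal_ideal O (y ^+ p * b ^+ j) `<=` principal_ideal O (n%:R ^+ p).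
  have eqk : n%:R ^+ p * (k ^+ p * b ^+ j) = y ^+ p * b ^+ j by rewrite mulrA -exprMn.
  split=> [Ok|/(_ _ (principal_mem _))[r Or]].
    apply: principal_sub; first by case: nznp.
    by exists (k ^+ p * b ^+ j).
  by rewrite -eqk => /(mulfI np0) <-.
have -> : (forall x, B x -> O (k * x)) <->
    mul_ideal (principal_ideal O y) B `<=` principal_ideal O n%:R.
  split=> [kB|sub x Bx].
    apply: mul_ideal_sub; first by case: nzn.
    move=> _ x [r Or <-] Bx; exists (k * (r * x)); last by rewrite !mulrA.
    by apply: kB; apply: idealM.
  have [r Or Dr] := sub _ (mul_ideal_mem (principal_mem y) Bx).
  by rewrite Dk mulrAC -Dr mulrAC divff ?mul1r.
have nzyB := nzideal_mul nzy nzB.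
have valE P : is_prime_ideal O P ->
  (ideal_val O P (principal_ideal O (n%:R ^+ p)) <=
     ideal_val O P (principal_ideal O (y ^+ p * b ^+ j)))%N =
  (ideal_val O P (principal_ideal O n%:R) <=
     ideal_val O P (mul_ideal (principal_ideal O y) B))%N.
  move=> prP; rewrite -mul_principal; try exact: O_exp.
  rewrite !ideal_valM ?valB //; try (apply: nzideal_principal; rewrite ?expf_neq0 //; exact: O_exp).
  rewrite !ideal_val_principalX // -!leq_subLR leq_divRL // mulnBl.
  by rewrite -!(mulnC p).
rewrite (ideal_val_subP nzyb nznp) (ideal_val_subP nzyB nzn).
by split=> le P prP; have := le P prP; rewrite valE.
Qed.

(** The right side says that the associated ideal and c O_K have the same inverse, and
    [ideal_inverse_sub] recovers an ideal from its inverse. *)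
Lemma associated_ideal_principalP (p j : nat) b c : (0 < p)%N -> O b -> b != 0 ->
  O c -> c != 0 ->
  associated_ideal O p (principal_ideal O b) j = principal_ideal O c <->
  forall k, O (k ^+ p * b ^+ j) <-> O (k * c).
Proof.
move=> p_gt0 Ob b0 Oc c0; have nzb := nzideal_principal Ob b0.
have [nzB _] := ideal_val_associated p j nzb; have [idB _] := nzB.
have nzc := nzideal_principal Oc c0; have [idc _] := nzc.
have kc k : (forall x, principal_ideal O c x -> O (k * x)) <-> O (k * c).
  split=> [|Okc _ [r Or <-]]; first by apply; exact: principal_mem.
  by rewrite mulrA; apply: OM.
split=> [eqB k|inv]; first by rewrite associated_inverse // eqB.
apply/seteqP; split; apply: ideal_inverse_sub => // k.
  by move/kc/inv/associated_inverse; apply.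
by move/associated_inverse => /(_ p_gt0 Ob b0) /inv /kc.
Qed.

(** Every prime over p divides p exactly once, so lying in all of these primes is enough to be
    divisible by p. *)
Lemma unramified_radical (p : nat) x n : prime p -> unramified_in K p ->
  O x -> principal_ideal O p%:R (x ^+ n) -> principal_ideal O p%:R x.
Proof.
move=> p_pr unr Ox pxn; have p_gt0 := prime_gt0 p_pr.
have [->|x0] := eqVneq x 0.
  by exists 0; [exact: (O_nat K 0) | rewrite mulr0].
have nzp := nzideal_principal (O_nat K p) (nat_neq0 K p_gt0); have [idp _] := nzp.
have nzx := nzideal_principal Ox x0.
suff: principal_ideal O x `<=` principal_ideal O p%:R by apply; exact: principal_mem.
apply/ideal_val_subP => // P prP; have idP := prime_ideal_ideal prP.
have [Pp|nPp] := pselect (P p%:R).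
  rewrite unr //; apply/ideal_val_geP => //; rewrite exp_ideal1; last exact: prime_nzideal.
  apply: principal_sub => //; apply: (prime_ideal_exp prP Ox (n := n)).
  exact: principal_sub pxn.
suff -> : ideal_val O P (principal_ideal O p%:R) = 0%N by [].
apply/eqP; rewrite -leqn0 leqNgt; apply/negP => /ideal_val_geP.
move=> /(_ prP nzp); rewrite exp_ideal1; last exact: prime_nzideal.
by move=> /(_ _ (principal_mem _)).
Qed.

End Factorization.

(** * Divisibility by 1 - zeta *)

Section Cyclotomic.
Variables (F : fieldType) (p : nat) (zeta : F).
Hypotheses (p_prime : prime p) (zeta_prim : p.-primitive_root zeta).

Let p_gt0 : (0 < p)%N := prime_gt0 p_prime.
Let p_gt1 : (1 < p)%N := prime_gt1 p_prime.

Lemma prim_root_Oint : zeta \in Oint F.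
Proof. by apply: (OintX p_gt0); rewrite prim_expr_order // rpred1. Qed.

Lemma prim_root_inverse : zeta^-1 = zeta ^+ p.-1.
Proof.
have z0 : zeta != 0 by rewrite (prim_root_eq0 zeta_prim) -lt0n.
by apply: (mulfI z0); rewrite divff // -exprS prednK ?prim_expr_order.
Qed.

Lemma sub1_prim_exp_neq0 k : (0 < k < p)%N -> 1 - zeta ^+ k != 0.
Proof.
case/andP=> k_gt0 lt_kp; rewrite subr_eq0 eq_sym -(prim_order_dvd zeta_prim).
by apply/negP => /(dvdn_leq k_gt0); rewrite leqNgt lt_kp.
Qed.

Lemma sub1_prim_neq0 : 1 - zeta != 0.
Proof. by rewrite -{1}[zeta]expr1 sub1_prim_exp_neq0. Qed.

Lemma Oint_sub1_exp (w : F) m : w \in Oint F -> 1 - w != 0 ->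
  (1 - w ^+ m) / (1 - w) \in Oint F.
Proof.
move=> Ow w1; rewrite -opprB subrX1 -mulNr opprB mulrAC divff // mul1r.
by rewrite rpred_sum // => i _; rewrite rpredX.
Qed.

Lemma Oint_sub1_ratio k : (0 < k < p)%N -> (1 - zeta) / (1 - zeta ^+ k) \in Oint F.
Proof.
move=> lt_k; have co_k : coprime k p.
  rewrite coprime_sym prime_coprime //; case/andP: lt_k => k_gt0 lt_kp.
  by apply/negP => /(dvdn_leq k_gt0); rewrite leqNgt lt_kp.
(* k^(p-2) inverts k modulo p, so the quotient takes the form (1 - w^m) / (1 - w) with w =
   zeta^k. *)
have {1}-> : zeta = (zeta ^+ k) ^+ (k ^ p.-2).
  rewrite -exprM -expnS -[LHS]expr1.
  have := Euler_exp_totient co_k; rewrite totient_prime // => e.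
  rewrite -(prim_expr_mod zeta_prim (_ ^ _)) prednK; last by rewrite -subn1 subn_gt0.
  by rewrite e modn_small.
by rewrite Oint_sub1_exp ?rpredX ?prim_root_Oint // sub1_prim_exp_neq0.
Qed.

Lemma prod_sub_prim_exp (x : F) :
  \prod_(1 <= k < p) (x - zeta ^+ k) = \sum_(i < p) x ^+ i.
Proof.
have: \prod_(1 <= k < p) ('X - (zeta ^+ k)%:P) = \sum_(i < p) 'X^i :> {poly F}.
  apply: (mulfI (negbT (polyXsubC_eq0 1))).
  by rewrite -subrX1 -(factor_Xn_sub_1 zeta_prim) [RHS]big_ltn // expr0.
move/(congr1 (horner^~ x)); rewrite horner_prod horner_sum.
under eq_bigr do rewrite !hornerE.
by under [in RHS]eq_bigr do rewrite !hornerE.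
Qed.

Lemma prod_sub1_prim_exp : \prod_(1 <= k < p) (1 - zeta ^+ k) = p%:R :> F.
Proof.
rewrite prod_sub_prim_exp; under eq_bigr do rewrite expr1n.
by rewrite sumr_const card_ord.
Qed.

(** Compare p = prod_k (1 - zeta^k) with (1 - zeta)^(p-1) factor by factor. Together with
    [Oint_pi_over_p] this makes the two associates. *)
Lemma Oint_p_over_pi : p%:R / (1 - zeta) ^+ p.-1 \in Oint F.
Proof.
rewrite -prod_sub1_prim_exp -subn1 -prodr_const_nat -prodf_div.
rewrite big_seq rpred_prod // => k; rewrite mem_index_iota => lt_k.
by rewrite Oint_sub1_exp ?prim_root_Oint ?sub1_prim_neq0.
Qed.

Lemma Oint_pi_over_p : (1 - zeta) ^+ p.-1 / p%:R \in Oint F.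
Proof.
rewrite -prod_sub1_prim_exp -subn1 -prodr_const_nat -prodf_div.
rewrite big_seq rpred_prod // => k; rewrite mem_index_iota.
exact: Oint_sub1_ratio.
Qed.

Lemma Oint_p_over_sub1 : p%:R / (1 - zeta) \in Oint F.
Proof.
rewrite -prod_sub1_prim_exp big_ltn // expr1 mulrAC divff ?sub1_prim_neq0 // mul1r.
by rewrite rpred_prod // => k _; rewrite rpredB ?rpred1 ?rpredX ?prim_root_Oint.
Qed.

Lemma Oint_prim_exp_cong m n : (zeta ^+ m - zeta ^+ n) / (1 - zeta) \in Oint F.
Proof.
have -> : zeta ^+ m - zeta ^+ n = (1 - zeta ^+ n) - (1 - zeta ^+ m) by ring.
by rewrite mulrBl rpredB // Oint_sub1_exp ?prim_root_Oint ?sub1_prim_neq0.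
Qed.

Lemma sum_prim_exp i j : (i < p)%N -> (j < p)%N ->
  \sum_(k < p) (zeta ^+ j / zeta ^+ i) ^+ k = ((i == j) * p)%N%:R.
Proof.
move=> lt_i lt_j; have z0 k : zeta ^+ k != 0.
  by rewrite expf_neq0 // (prim_root_eq0 zeta_prim) -lt0n.
have [->|neq_ij] := eqVneq i j.
  rewrite divff //; under eq_bigr do rewrite expr1n.
  by rewrite sumr_const card_ord mul1n.
rewrite mul0n; have: zeta ^+ j / zeta ^+ i - 1 != 0.
  rewrite subr_eq0 -(inj_eq (mulIf (z0 i))) divfK // mul1r (eq_prim_root_expr zeta_prim).
  by rewrite !modn_small // eq_sym.
move=> w1; apply: (mulfI w1); rewrite -subrX1 mulr0 expr_div_n.
by rewrite ![_ ^+ _ ^+ p]exprAC (prim_expr_order zeta_prim) !expr1n divr1 subrr.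
Qed.

(* alpha = 1 + (1 - zeta) rho turns alpha^p - 1 = p^2 c into a monic equation
   for rho with integral coefficients. *)
Lemma Oint_sub1_cong (alpha c : F) : c \in Oint F -> alpha ^+ p - 1 = p%:R ^+ 2 * c ->
  (alpha - 1) / (1 - zeta) \in Oint F.
Proof.
move=> Oc Da; set pi := 1 - zeta; have pi0 : pi != 0 := sub1_prim_neq0.
(* With rho = (alpha - 1) / pi one has alpha - zeta^k = pi (rho + (1 - zeta^k) / pi), so q(rho) =
   (alpha^p - 1 - p^2 c) / pi^p. *)
pose q := \prod_(0 <= k < p) ('X - (- ((1 - zeta ^+ k) / pi))%:P) - ((p%:R ^+ 2 * c) / pi ^+ p)%:P.
have Ok k : (1 - zeta ^+ k) / pi \in Oint F by rewrite Oint_sub1_exp ?prim_root_Oint.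
apply: (@Oint_root_monic _ q).
- rewrite /q monicE lead_coefDl; last first.
    rewrite size_polyN (leq_ltn_trans (size_polyC_leq1 _)) // big_mkord size_prod_XsubC.
    by rewrite /index_enum -enumT size_enum_ord ltnS.
  by rewrite -monicE; apply: monic_prod_XsubC.
- rewrite rootE /q !hornerE horner_prod.
  under eq_bigr do rewrite hornerXsubC opprK -mulrDl subrKA.
  rewrite prodf_div prodr_const_nat subn0.
  have := congr1 (horner^~ alpha) (factor_Xn_sub_1 zeta_prim).
  rewrite horner_prod !hornerE Da; under eq_bigr do rewrite !hornerE.
  by move=> ->; rewrite subrr.
- apply: rpredB; last rewrite polyOverC.
    by apply: rpred_prod => k _; rewrite polyOverXsubC rpredN.
  (* One factor p absorbs pi and the other absorbs pi^(p-1). *)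
  have -> : p%:R ^+ 2 * c / pi ^+ p = (p%:R / pi) * (p%:R / pi ^+ p.-1) * c.
      have -> : pi ^+ p = pi * pi ^+ p.-1 by rewrite -exprS prednK.
      by rewrite invfM; ring.
  by do 2?apply: rpredM; rewrite ?Oint_p_over_sub1 ?Oint_p_over_pi.
Qed.

Lemma Oint_mean_powers (alpha : F) : (alpha - 1) / (1 - zeta) \in Oint F ->
  p%:R^-1 * \sum_(i < p) alpha ^+ i \in Oint F.
Proof.
move=> Oa; rewrite -prod_sub_prim_exp -prod_sub1_prim_exp mulrC -prodf_div.
rewrite big_seq rpred_prod // => k; rewrite mem_index_iota => lt_k.
have k0 := sub1_prim_exp_neq0 lt_k; have pi0 := sub1_prim_neq0.
have -> : (alpha - zeta ^+ k) / (1 - zeta ^+ k) =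
    1 + (alpha - 1) / (1 - zeta) * ((1 - zeta) / (1 - zeta ^+ k)).
  by field; rewrite k0 pi0.
by rewrite rpredD ?rpred1 // rpredM ?Oint_sub1_ratio.
Qed.

End Cyclotomic.

(** * Integers of L in the basis alpha^j, and the diagonal maps preserving them *)

Section Kummer.
Variables (K : fieldExtType rat) (E : splittingFieldType K) (p : nat).
Variables (zeta alpha : E) (L : {subfield E}) (a : K) (sigma : gal_of {:E}).
Hypotheses (p_prime : prime p) (zeta_prim : p.-primitive_root zeta).
Hypothesis p_unramified : unramified_in K p.
Hypothesis L_def : (L : {vspace E}) = <<1; alpha>>%VS.
Hypothesis L_degree : \dim L = p.
Hypothesis a_int : algebraic_integers a.
Hypothesis a_def : alpha ^+ p = a%:A.
Hypothesis a_cong : exists2 c : K, algebraic_integers c & a - 1 = p%:R ^+ 2 * c.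
Hypothesis sigma_alpha : sigma alpha = zeta * alpha.
Hypothesis sigma_zeta : sigma zeta = zeta.

Let p_gt0 : (0 < p)%N := prime_gt0 p_prime.
Let pE : p%:R != 0 :> E.
Proof. by rewrite -(rmorph_nat (in_alg E)) fmorph_eq0 nat_neq0. Qed.
Let pK : p%:R != 0 :> K. Proof. exact: nat_neq0. Qed.
Let pi := 1 - zeta.
Let pi0 : pi != 0 := sub1_prim_neq0 p_prime zeta_prim.

Lemma algM (k l : K) : (k * l)%:A = k%:A * l%:A :> E.
Proof. exact: (rmorphM (in_alg E)). Qed.
Lemma alg_nat n : n%:R%:A = n%:R :> E. Proof. exact: (rmorph_nat (in_alg E)). Qed.
Lemma algV (k : K) : (k^-1)%:A = k%:A^-1 :> E. Proof. exact: (fmorphV (in_alg E)). Qed.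
Lemma algX (k : K) n : (k ^+ n)%:A = k%:A ^+ n :> E. Proof. exact: (rmorphXn (in_alg E)). Qed.
Lemma alg_eq0 (k : K) : (k%:A == 0 :> E) = (k == 0). Proof. exact: (fmorph_eq0 (in_alg E)). Qed.
Lemma alg_inj : injective (fun k : K => k%:A : E). Proof. exact: (fmorph_inj (in_alg E)). Qed.

Lemma alpha_neq0 : alpha != 0.
Proof.
apply/eqP => alpha0; have := prime_gt1 p_prime.
by rewrite -L_degree L_def alpha0 Fadjoin0 dimv1.
Qed.

Lemma alpha_Oint : alpha \in Oint E.
Proof. by apply: (OintX p_gt0); rewrite a_def Oint_alg; apply/OintP. Qed.

Lemma alpha_cong : (alpha - 1) / pi \in Oint E.
Proof.
have [c /OintP Oc Dc] := a_cong; apply: (Oint_sub1_cong p_prime zeta_prim (c := c%:A)).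
  by rewrite Oint_alg.
by rewrite a_def -alg_nat -algX -algM -Dc scalerBl scale1r.
Qed.

Lemma alphaX_cong n : (alpha ^+ n - 1) / pi \in Oint E.
Proof.
rewrite subrX1 mulrAC rpredM ?alpha_cong // rpred_sum // => i _.
by rewrite rpredX ?alpha_Oint.
Qed.

Lemma sigmaX_alpha k : (sigma ^+ k)%g alpha = zeta ^+ k * alpha.
Proof.
elim: k => [|k IHk]; first by rewrite expg0 gal_id mul1r.
rewrite expgSr galM ?memvf // IHk rmorphM rmorphXn /= sigma_zeta sigma_alpha.
by rewrite exprSr mulrA.
Qed.

Lemma sigmaX_term k (c : K) j :
  (sigma ^+ k)%g (c%:A * alpha ^+ j) = c%:A * (zeta ^+ j) ^+ k * alpha ^+ j.
Proof.
rewrite mulr_algl linearZ /= rmorphXn /= sigmaX_alpha exprMn -exprM mulnC exprM.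
by rewrite mulr_algl scalerAl.
Qed.

Definition expand (c : 'I_p -> K) : E := \sum_(j < p) (c j)%:A * alpha ^+ j.

Lemma expand_mem c : expand c \in (L : {vspace E}).
Proof.
have Lal : alpha \in (L : {vspace E}) by rewrite L_def memv_adjoin.
by apply: rpred_sum => j _; rewrite mulr_algl memvZ // rpredX.
Qed.

Lemma expandP x : x \in (L : {vspace E}) -> exists c, x = expand c.
Proof.
rewrite L_def => Lx; have Dx := Fadjoin_poly_eq Lx.
have /polyOver1P[q Dq] := Fadjoin_polyOver 1%AS alpha x.
have sz_q : (size (Fadjoin_poly 1%AS alpha x) <= p)%N.
  apply: leq_trans (size_Fadjoin_poly _ _ _) _.
  by have := dim_Fadjoin 1%AS alpha; rewrite -L_def L_degree dimv1 muln1 => <-.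
exists (fun j => q`_j); rewrite -[LHS]Dx (horner_coef_wide _ sz_q) Dq.
by apply: eq_bigr => j _; rewrite coef_map.
Qed.

(** A Lagrange resolvent: on L it is p times the projection onto K alpha^i. Leaving out the division
    by p keeps it integral. *)
Definition component (i : nat) (x : E) : E :=
  \sum_(k < p) (zeta ^+ i)^-1 ^+ k * (sigma ^+ k)%g x.

Lemma component_expand (i : 'I_p) c :
  component i (expand c) = p%:R * ((c i)%:A * alpha ^+ i).
Proof.
rewrite /component /expand; under eq_bigr => k _.
  rewrite linear_sum mulr_sumr /=; under eq_bigr => j _ do
    rewrite sigmaX_term mulrA mulrCA -exprMn [_^-1 * _]mulrC.
  over.
rewrite exchange_big (bigD1 i) //= [X in _ + X]big1 ?addr0 => [|j neq_ji].
  rewrite -mulr_suml -mulr_sumr (sum_prim_exp p_prime zeta_prim) // eqxx mul1n.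
  by rewrite mulrAC mulrC.
rewrite -mulr_suml -mulr_sumr (sum_prim_exp p_prime zeta_prim) //.
have -> : (i == j :> nat) = false by rewrite eq_sym; exact: negbTE.
by rewrite mul0n mulr0 mul0r.
Qed.

Lemma expand_inj c c' : expand c = expand c' -> c =1 c'.
Proof.
move=> eq_c i; have /(mulfI pE) : p%:R * ((c i)%:A * alpha ^+ i) = p%:R * ((c' i)%:A * alpha ^+ i).
  by rewrite -!component_expand eq_c.
by move/(mulIf (expf_neq0 _ alpha_neq0)); exact: alg_inj.
Qed.

Lemma Oint_gal (g : gal_of {:E}) x : x \in Oint E -> g x \in Oint E.
Proof. by move=> Ox; rewrite (Oint_rmorph g). Qed.

Lemma component_Oint i x : x \in Oint E -> component i x \in Oint E.
Proof.
move=> Ox; rewrite rpred_sum // => k _; rewrite rpredM ?Oint_gal //.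
rewrite -exprVn (prim_root_inverse p_prime zeta_prim) !rpredX //.
exact: (prim_root_Oint p_prime zeta_prim).
Qed.

(** All powers of zeta are congruent modulo pi, so the two resolvents have congruent coefficients.
    This is the necessity of the congruences between components. *)
Lemma component_cong i j x : x \in Oint E ->
  (component i x - component j x) / pi \in Oint E.
Proof.
move=> Ox; rewrite /component -sumrB mulr_suml rpred_sum // => k _.
rewrite -mulrBl mulrAC rpredM ?Oint_gal // -!exprVn (prim_root_inverse p_prime zeta_prim).
by rewrite -!exprM (Oint_prim_exp_cong p_prime zeta_prim).
Qed.

(** Since p and pi^(p-1) are associates, p divides k^(p-1), and p O_K is radical. This carries
    congruences from O_E down to O_K. *)
Lemma Oint_mod_p (k : K) : k \in Oint K -> k%:A / pi \in Oint E -> k / p%:R \in Oint K.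
Proof.
move=> Ok Okpi; have: k ^+ p.-1 / p%:R \in Oint K.
  rewrite -(Oint_alg E) algM algX algV alg_nat.
  rewrite -[k%:A](divfK pi0) exprMn -mulrA rpredM ?rpredX //.
  exact: Oint_pi_over_p.
move=> /OintP Okp; have [r /OintP Or <-] : principal_ideal (@algebraic_integers K) p%:R k.
  apply: (unramified_radical (n := p.-1) p_prime p_unramified); first exact/OintP.
  by exists (k ^+ p.-1 / p%:R) => //; rewrite mulrC divfK.
by rewrite mulrAC divff ?mul1r.
Qed.

(* Multiplying by a = 1 + p^2 c moves the u i into K alpha^i with integral
   coordinates congruent modulo p; then the mean of the powers of alpha is used. *)
Lemma mean_Oint (u : 'I_p -> E) :
  (forall i, exists k : K, u i = k%:A * alpha ^+ i) -> (forall i, u i \in Oint E) ->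
  (forall i j, (u i - u j) / pi \in Oint E) -> p%:R^-1 * \sum_i u i \in Oint E.
Proof.
move=> hom_u Ou cong_u; have Oal := alpha_Oint; have al0 := alpha_neq0.
have y_ex i : exists y : K, [/\ y \in Oint K, a%:A * u i = y%:A * alpha ^+ i &
    y%:A = u i * alpha ^+ (p - i)].
  have [k Dk] := hom_u i.
  have Dy : (a * k)%:A = u i * alpha ^+ (p - i).
    by rewrite Dk -mulrA -exprD subnKC 1?ltnW // a_def algM mulrC.
  exists (a * k); split=> //; last by rewrite Dk algM mulrA.
  by rewrite -(Oint_alg E) Dy rpredM ?rpredX.
have [y Hy] := choice y_ex.
have {Hy y_ex} [Oy Dau Dy] : [/\ forall i, y i \in Oint K,
    forall i, a%:A * u i = (y i)%:A * alpha ^+ i & forall i, (y i)%:A = u i * alpha ^+ (p - i)].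
  by split=> i; have [] := Hy i.
(* As alpha is 1 modulo pi, [y i] is congruent to [u i]. So all the [y i] are congruent modulo pi,
   and then modulo p by [Oint_mod_p]. *)
pose i0 := Ordinal p_gt0; pose z i := (y i - y i0) / p%:R.
have Oz i : z i \in Oint K.
  apply: Oint_mod_p; first by rewrite rpredB.
  rewrite scalerBl !Dy.
  have -> : (u i * alpha ^+ (p - i) - u i0 * alpha ^+ (p - i0)) / pi =
     u i * ((alpha ^+ (p - i) - 1) / pi) + (u i - u i0) / pi -
     u i0 * ((alpha ^+ (p - i0) - 1) / pi) by ring.
  apply: rpredB; last by rewrite rpredM ?alphaX_cong.
  by apply: rpredD => //; rewrite rpredM ?alphaX_cong.
set X := p%:R^-1 * _.
have OaX : a%:A * X \in Oint E.
  (* Replacing every [y i] by [y i0] leaves a multiple of the mean of the powers of alpha, with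
     errors divisible by p. *)
  have -> : a%:A * X = (y i0)%:A * (p%:R^-1 * \sum_(i < p) alpha ^+ i) +
      \sum_(i < p) (z i)%:A * alpha ^+ i.
    rewrite /X mulrCA !mulr_sumr -big_split /=; apply: eq_bigr => i _.
    by rewrite Dau /z algM algV alg_nat scalerBl; ring.
  apply: rpredD.
    by rewrite rpredM ?Oint_alg // (Oint_mean_powers p_prime zeta_prim) ?alpha_cong.
  by apply: rpred_sum => i _; rewrite rpredM ?Oint_alg ?rpredX.
have [c /OintP Oc Dc] := a_cong.
(* The factor a is removed again: a X - X = p^2 c X, and p X is the integral sum of the [u i]. *)
have -> : X = a%:A * X - p%:R * c%:A * \sum_i u i.
  have -> : \sum_i u i = p%:R * X by rewrite /X mulrA divff // mul1r.
  have -> : a = 1 + p%:R ^+ 2 * c by rewrite -Dc addrC subrK.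
  by rewrite scalerDl scale1r algM algX alg_nat; ring.
by apply: rpredB => //; rewrite !rpredM ?rpred_nat ?Oint_alg ?rpred_sum.
Qed.

Lemma expand_components c :
  expand c = p%:R^-1 * \sum_i (p%:R * ((c i)%:A * alpha ^+ i)).
Proof. by rewrite -mulr_sumr mulrA mulVf ?mul1r. Qed.

Lemma expand_component_Oint c i : expand c \in Oint E ->
  p%:R * ((c i)%:A * alpha ^+ i) \in Oint E.
Proof. by move=> Oc; rewrite -component_expand component_Oint. Qed.

(** The associated order in eigenvalue coordinates; [order_stable] and [stable_order] translate
    between the two. *)
Definition stable (lam : 'I_p -> K) :=
  forall c, expand c \in Oint E -> expand (fun i => lam i * c i) \in Oint E.

Lemma expand_single (j : 'I_p) (k : K) :
  expand (fun i => if i == j then k else 0) = k%:A * alpha ^+ j.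
Proof.
rewrite /expand (bigD1 j) //= eqxx big1 ?addr0 // => i /negbTE ->.
by rewrite scale0r mul0r.
Qed.

Lemma eq_expand c c' : c =1 c' -> expand c = expand c'.
Proof. by move=> eq_c; apply: eq_bigr => i _; rewrite eq_c. Qed.

Lemma expand_mulX (j : 'I_p) (k : K) : k%:A * alpha ^+ j \in Oint E -> k * a \in Oint K.
Proof.
move=> Ok; rewrite -(Oint_alg E) algM -a_def -(subnKC (ltnW (ltn_ord j))) exprD mulrA.
by rewrite rpredM ?rpredX ?alpha_Oint.
Qed.

Lemma a_neq0 : a != 0.
Proof. by rewrite -(alg_eq0 a) -a_def expf_neq0 ?alpha_neq0. Qed.

(** Iterating on alpha^j keeps lam_j^n alpha^j integral, so a is a common denominator of all powers
    of lam_j. *)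
Lemma stable_Oint lam j : stable lam -> lam j \in Oint K.
Proof.
move=> st; apply: (Oint_completely_closed a_neq0) => n; rewrite mulrC.
apply: (expand_mulX (j := j)); elim: n => [|n IHn].
  by rewrite scale1r mul1r rpredX ?alpha_Oint.
move: IHn; rewrite -!expand_single => /st.
rewrite (eq_expand (c' := fun i => if i == j then lam j ^+ n.+1 else 0)) // => i.
by case: eqP => [->|_]; rewrite ?exprS ?mulr0.
Qed.

Lemma stable_single_Oint lam j : stable lam -> (forall i, i != j -> lam i = 0) ->
  lam j / p%:R \in Oint K.
Proof.
move=> st lam0; have Olam := stable_Oint j st.
have: expand (fun=> p%:R^-1) \in Oint E.
  rewrite /expand -mulr_sumr algV alg_nat.
  by rewrite (Oint_mean_powers p_prime zeta_prim) ?alpha_cong.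
move/st; rewrite (eq_expand (c' := fun i => if i == j then lam j / p%:R else 0)); last first.
  by move=> i; case: eqP => [-> //|/eqP/lam0 ->]; rewrite mul0r.
rewrite expand_single => /expand_mulX Oa; have [c /OintP Oc Dc] := a_cong.
have -> : lam j / p%:R = lam j / p%:R * a - p%:R * c * lam j.
  have -> : a = 1 + p%:R ^+ 2 * c by rewrite -Dc addrC subrK.
  by field.
by apply: rpredB => //; rewrite !rpredM ?rpred_nat.
Qed.

(** On L this vector acts as m times [component j]. *)
Lemma single_stable (j : 'I_p) (m : K) : m \in Oint K ->
  stable (fun i => if i == j then p%:R * m else 0).
Proof.
move=> Om c Oc; rewrite (eq_expand (c' := fun i => if i == j then m * (p%:R * c j) else 0)).
  by rewrite expand_single !algM -!mulrA rpredM ?Oint_alg // alg_nat expand_component_Oint.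
by move=> i; case: eqP => [->|_]; [ring | rewrite mul0r].
Qed.

(** The [mu] are the coordinates of p c_i alpha^i on u_i. They preserve O_L because, for a second
    integer with coordinates w, the mu_i w_i u_i are again congruent modulo pi and [mean_Oint]
    applies. *)
Lemma generator_stable (u : 'I_p -> E) :
  (forall i, exists k : K, u i = k%:A * alpha ^+ i) -> (forall i, u i \in Oint E) ->
  (forall (i : 'I_p) (k : K), k%:A * alpha ^+ i \in Oint E ->
     exists2 m, m \in Oint K & k%:A * alpha ^+ i = m%:A * u i) ->
  p%:R^-1 * \sum_i u i \in Oint E ->
  forall c, expand c \in Oint E -> exists2 mu : 'I_p -> K,
    expand c = p%:R^-1 * \sum_i (mu i)%:A * u i & stable mu.
Proof.
move=> hom_u Ou gen_u Ou_mean.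
have dec c : expand c \in Oint E -> exists mu : 'I_p -> K, (forall i, mu i \in Oint K) /\
    forall i, p%:R * ((c i)%:A * alpha ^+ i) = (mu i)%:A * u i.
  move=> Oc; suff /choice[mu Hmu] : forall i, exists m, m \in Oint K /\
      p%:R * ((c i)%:A * alpha ^+ i) = m%:A * u i.
    by exists mu; split=> i; have [] := Hmu i.
  move=> i; have := expand_component_Oint i Oc; rewrite mulrA -alg_nat -algM.
  by case/gen_u => m Om ->; exists m.
have [k Dk] := choice hom_u.
have mean_u : p%:R^-1 * \sum_i u i = expand (fun i => k i / p%:R).
  rewrite /expand mulr_sumr; apply: eq_bigr => i _.
  by rewrite algM algV alg_nat Dk; ring.
have cong_c c i j : expand c \in Oint E ->
    (p%:R * ((c i)%:A * alpha ^+ i) - p%:R * ((c j)%:A * alpha ^+ j)) / pi \in Oint E.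
  by move=> Oc; rewrite -!component_expand component_cong.
have cong_u i j : (u i - u j) / pi \in Oint E.
  have Dpk l : p%:R * ((k l / p%:R)%:A * alpha ^+ l) = u l.
    by rewrite algM algV alg_nat Dk; field.
  by have := cong_c (fun i => k i / p%:R) i j; rewrite -mean_u !Dpk; apply.
(* u_i divides alpha^i, and alpha^i alpha^(p-i) = a is 1 modulo p^2, so the cofactor inverts u_i
   modulo pi. *)
have inv_u i : exists2 s, s \in Oint E & (1 - u i * s) / pi \in Oint E.
  have [|m Om Dm] := gen_u i 1; first by rewrite scale1r mul1r rpredX ?alpha_Oint.
  rewrite scale1r mul1r in Dm.
  exists (m%:A * alpha ^+ (p - i)); first by rewrite rpredM ?Oint_alg ?rpredX ?alpha_Oint.
  rewrite mulrA [u i * _]mulrC -Dm -exprD subnKC 1?ltnW // a_def.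
  have [c /OintP Oc Dc] := a_cong.
  have -> : a = 1 + p%:R ^+ 2 * c by rewrite -Dc addrC subrK.
  rewrite scalerDl scale1r algM algX alg_nat.
  have -> : (1 - (1 + p%:R ^+ 2 * c%:A)) / pi = - ((p%:R / pi) * (p%:R * c%:A)) by ring.
  by rewrite rpredN rpredM ?(Oint_p_over_sub1 p_prime zeta_prim) // rpredM ?rpred_nat ?Oint_alg.
move=> c Oc; have [mu [Omu Dmu]] := dec c Oc.
exists mu; first by rewrite expand_components; under eq_bigr do rewrite Dmu.
move=> c' Oc'; have [w [Ow Dw]] := dec c' Oc'.
have -> : expand (fun i => mu i * c' i) = p%:R^-1 * \sum_i (mu i * w i)%:A * u i.
  rewrite expand_components; congr (_ * _); apply: eq_bigr => i _.
  by rewrite !algM -!mulrA -Dw; ring.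
apply: mean_Oint => [i|i|i j].
- by exists (mu i * w i * k i); rewrite Dk !algM; ring.
- by rewrite rpredM ?Oint_alg ?rpredM.
have [s Os Ds] := inv_u j; rewrite !algM.
have := cong_c _ i j Oc; have := cong_c _ i j Oc'; rewrite !Dmu !Dw => congW congA.
(* The u i are invertible modulo 1 - zeta, so congruences may be divided by them. *)
have -> : ((mu i)%:A * (w i)%:A * u i - (mu j)%:A * (w j)%:A * u j) / pi =
  (mu i)%:A * (w i)%:A * u i * ((1 - u j * s) / pi)
  - (mu i)%:A * (w i)%:A * u i * s * ((u i - u j) / pi)
  + s * ((mu i)%:A * u i) * (((w i)%:A * u i - (w j)%:A * u j) / pi)
  + s * ((w j)%:A * u j) * (((mu i)%:A * u i - (mu j)%:A * u j) / pi)
  - (mu j)%:A * (w j)%:A * u j * ((1 - u j * s) / pi) by ring.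
have OA m (i' : 'I_p) : m \in Oint K -> m%:A * u i' \in Oint E.
  by move=> Om; rewrite rpredM ?Oint_alg.
have OB (i' : 'I_p) : (mu i')%:A * (w i')%:A * u i' \in Oint E.
  by rewrite -mulrA rpredM ?Oint_alg ?OA.
have t1 : (mu i)%:A * (w i)%:A * u i * ((1 - u j * s) / pi) \in Oint E by exact: rpredM.
have t2 : (mu i)%:A * (w i)%:A * u i * s * ((u i - u j) / pi) \in Oint E.
  by apply: rpredM (cong_u i j); apply: rpredM.
have t3 : s * ((mu i)%:A * u i) * (((w i)%:A * u i - (w j)%:A * u j) / pi) \in Oint E.
  by apply: rpredM congW; apply: rpredM (OA _ _ (Omu i)).
have t4 : s * ((w j)%:A * u j) * (((mu i)%:A * u i - (mu j)%:A * u j) / pi) \in Oint E.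
  by apply: rpredM congA; apply: rpredM (OA _ _ (Ow j)).
have t5 : (mu j)%:A * (w j)%:A * u j * ((1 - u j * s) / pi) \in Oint E by exact: rpredM.
by apply: rpredB t5; apply: rpredD t4; apply: rpredD t3; apply: rpredB t2.
Qed.

(** As beta^p lies in K, sigma beta / beta is some zeta^r, and the resolvents then annihilate every
    coordinate of beta except the r-th. *)
Lemma kummer_eigen (beta : E) (b : K) : beta \in (L : {vspace E}) -> beta != 0 ->
  beta ^+ p = b%:A -> exists (r : 'I_p) (k : K), beta = k%:A * alpha ^+ r.
Proof.
move=> /expandP[c Dc] beta0 Db.
have /(prim_rootP zeta_prim)[r Dr] : (sigma beta / beta) ^+ p = 1.
  rewrite expr_div_n -rmorphXn /= Db linearZ /= rmorph1 divff //.
  by rewrite -Db expf_neq0.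
have {}Dr : sigma beta = zeta ^+ r * beta by rewrite -Dr divfK.
have Dk k : (sigma ^+ k)%g beta = (zeta ^+ r) ^+ k * beta.
  elim: k => [|k IHk]; first by rewrite expg0 gal_id mul1r.
  rewrite expgSr galM ?memvf // IHk rmorphM !rmorphXn /= sigma_zeta Dr.
  by rewrite exprSr mulrA.
exists r, (c r); rewrite -expand_single Dc; apply: eq_expand => i.
have [->//|neq_ir] := eqVneq i r.
have := component_expand i c; rewrite -Dc /component.
under eq_bigr do rewrite Dk mulrA -exprMn [_^-1 * _]mulrC.
rewrite -mulr_suml (sum_prim_exp p_prime zeta_prim) //.
have -> : (i == r :> nat) = false by exact: negbTE.
rewrite mul0n mul0r => /esym/eqP; rewrite !mulf_eq0 (negbTE pE) alg_eq0.
by rewrite (negbTE (expf_neq0 _ alpha_neq0)) orbF => /eqP.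
Qed.

End Kummer.

Lemma eqmod_mul_cancel (p r m n : nat) : coprime p r ->
  r * m = r * n %[mod p] -> m = n %[mod p].
Proof.
move=> co_r; wlog le_nm : m n / (n <= m)%N => [IH eq_mn|/eqP].
  by have [/IH|/ltnW/IH] := leqP n m; [apply | move/(_ (esym eq_mn))].
by rewrite eqn_mod_dvd ?leq_mul2l ?le_nm ?orbT // -mulnBr Gauss_dvdr // -eqn_mod_dvd // => /eqP.
Qed.

Lemma mul_ord_inj (p r : nat) (p_gt0 : (0 < p)%N) : coprime p r ->
  injective (fun k : 'I_p => Ordinal (ltn_pmod (r * k) p_gt0)).
Proof.
move=> co_r k l /(congr1 val) /= /(eqmod_mul_cancel co_r).
by rewrite !modn_small // => /val_inj.
Qed.

(** * The Galois group, its cosets, and the eigenvalues of the Hopf algebra *)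

Section HopfStructure.
Variables (K : fieldExtType rat) (E : splittingFieldType K) (p : nat).
Variables (zeta alpha : E) (L : {subfield E}) (a : K) (d : nat).
Variables (sigma tau : gal_of {:E}) (eta : {perm {set gal_of {:E}}}).
Hypotheses (p_prime : prime p) (zeta_prim : p.-primitive_root zeta).
Hypothesis L_def : (L : {vspace E}) = <<1; alpha>>%VS.
Hypothesis L_degree : \dim L = p.
Hypothesis a_def : alpha ^+ p = a%:A.
Hypothesis E_def : <<L; zeta>>%VS = fullv.
Hypothesis d_prim : p.-1.-primitive_root (d%:R : 'F_p).
Hypothesis sigma_alpha : sigma alpha = zeta * alpha.
Hypothesis sigma_zeta : sigma zeta = zeta.
Hypothesis tau_alpha : tau alpha = alpha.
Hypothesis tau_zeta : tau zeta = zeta ^+ d.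
Hypothesis eta_def : is_eta sigma tau eta.

Let p_gt0 : (0 < p)%N := prime_gt0 p_prime.
Let pE : p%:R != 0 :> E.
Proof. by rewrite -(rmorph_nat (in_alg E)) fmorph_eq0 nat_neq0. Qed.
Let al0 : alpha != 0 := alpha_neq0 p_prime L_def L_degree.

Lemma gal_group_full g : g \in gal_group E.
Proof. by rewrite /gal_group gal_kHom ?sub1v // k1AHom. Qed.

Lemma gal_ext (g h : gal_of {:E}) : g alpha = h alpha -> g zeta = h zeta -> g = h.
Proof.
move=> eq_alpha eq_zeta; apply/eqP/gal_eqP => x _.
have eqL y : y \in (L : {vspace E}) -> g y = h y.
  case/(expandP L_def L_degree) => c ->; rewrite !linear_sum; apply: eq_bigr => j _.
  by rewrite mulr_algl !linearZ /= !rmorphXn /= eq_alpha.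
have /Fadjoin_polyP[q Lq ->] : x \in <<L; zeta>>%VS by rewrite E_def memvf.
rewrite horner_coef !linear_sum; apply: eq_bigr => i _ /=.
by rewrite !rmorphM !rmorphXn /= eq_zeta eqL // (polyOverP Lq).
Qed.

Lemma tauX_alpha s : (tau ^+ s)%g alpha = alpha.
Proof.
elim: s => [|s IHs]; first by rewrite expg0 gal_id.
by rewrite expgSr galM ?memvf // IHs tau_alpha.
Qed.

Lemma tauX_zeta s : (tau ^+ s)%g zeta = zeta ^+ (d ^ s).
Proof.
elim: s => [|s IHs]; first by rewrite expg0 gal_id.
by rewrite expgSr galM ?memvf // IHs rmorphXn /= tau_zeta -exprM expnS.
Qed.

Lemma sigmaX_zeta k : (sigma ^+ k)%g zeta = zeta.
Proof.
elim: k => [|k IHk]; first by rewrite expg0 gal_id.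
by rewrite expgSr galM ?memvf // IHk sigma_zeta.
Qed.

Let sigmaX k : (sigma ^+ k)%g alpha = zeta ^+ k * alpha := sigmaX_alpha sigma_alpha sigma_zeta k.

Lemma sigma_order : (sigma ^+ p = 1)%g.
Proof.
apply: gal_ext; last by rewrite sigmaX_zeta gal_id.
by rewrite sigmaX prim_expr_order // mul1r gal_id.
Qed.

Lemma sigma_tau i s : (sigma ^+ i * tau ^+ s = tau ^+ s * sigma ^+ (i * d ^ s))%g.
Proof.
apply: gal_ext; rewrite !galM ?memvf //.
  by rewrite sigmaX rmorphM rmorphXn /= !tauX_alpha sigmaX tauX_zeta -exprM mulnC.
by rewrite sigmaX_zeta tauX_zeta rmorphXn /= sigmaX_zeta.
Qed.

(** g sends alpha to some zeta^i alpha and zeta to some zeta^m with m prime to p. As d is a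
    primitive root, m is a power of d modulo p. *)
Lemma gal_decomp (g : gal_of {:E}) : exists s i,
  g = (tau ^+ s * sigma ^+ i)%g /\ g zeta = zeta ^+ (d ^ s).
Proof.
have [i Di] : exists i : nat, g alpha = zeta ^+ i * alpha.
  have /(prim_rootP zeta_prim)[i Di] : (g alpha / alpha) ^+ p = 1.
    rewrite expr_div_n -rmorphXn /= a_def linearZ /= rmorph1 divff //.
    by rewrite -a_def expf_neq0.
  by exists i; rewrite -Di divfK.
have [s Ds] : exists s : nat, g zeta = zeta ^+ (d ^ s).
  have /(prim_rootP zeta_prim)[m Dm] : (g zeta) ^+ p = 1.
    by rewrite -rmorphXn /= prim_expr_order // rmorph1.
  have m_gt0 : (0 < m)%N.
    rewrite lt0n; apply/eqP => m0; have := sub1_prim_neq0 p_prime zeta_prim.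
    rewrite subr_eq0 eq_sym; case/eqP; apply: (fmorph_inj g).
    by rewrite rmorph1 /= Dm m0.
  have co_m : coprime m p.
    rewrite coprime_sym prime_coprime //.
    by apply/negP => /(dvdn_leq m_gt0); rewrite leqNgt ltn_ord.
  have /(prim_rootP d_prim)[s Ds] : (m%:R : 'F_p) ^+ p.-1 = 1.
    rewrite -natrX -(Fp_nat_mod p_prime) -totient_prime // Euler_exp_totient //.
    by rewrite Fp_nat_mod.
  exists s; rewrite Dm; apply/eqP; rewrite (eq_prim_root_expr zeta_prim).
  by rewrite -!(val_Fp_nat p_prime) natrX Ds.
exists s, i; split=> //; apply: gal_ext; rewrite galM ?memvf //.
  by rewrite tauX_alpha sigmaX.
by rewrite tauX_zeta rmorphXn /= sigmaX_zeta.
Qed.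

Local Notation X i := (<[tau]> :* sigma ^+ i)%g.

Lemma rcoset_sigma_mod i : X (i %% p) = X i.
Proof. by rewrite (expg_mod _ sigma_order). Qed.

Lemma cosetsP (A : {set gal_of {:E}}) : reflect (exists i, A = X i) (A \in cosets tau).
Proof.
apply: (iffP rcosetsP) => [[g _ ->]|[i ->]]; last first.
  by exists (sigma ^+ i)%g => //; exact: gal_group_full.
have [s [i [-> _]]] := gal_decomp g; exists i.
by rewrite rcosetM rcoset_id // mem_cycle.
Qed.

Lemma rcoset_sigma_inj i j : X i = X j -> i = j %[mod p].
Proof.
move=> eqX; have /rcosetP[t /cycleP[s ->] Di] : (sigma ^+ i)%g \in X j.
  by rewrite -eqX rcoset_refl.
have /eqP := congr1 (fun g : gal_of {:E} => g alpha) Di.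
rewrite galM ?memvf // tauX_alpha !sigmaX (inj_eq (mulIf al0)).
by rewrite (eq_prim_root_expr zeta_prim) => /eqP.
Qed.

(** On cosets indexed by Z/p the group acts by affine maps: moving sigma^i past tau^s multiplies i
    by d^s, and the power of tau is absorbed by the subgroup. *)
Lemma translationE g s j i : g = (tau ^+ s * sigma ^+ j)%g ->
  translation tau g (X i) = X (i * d ^ s + j).
Proof.
move=> Dg; have actE k : actperm 'Rs g (X k) = X (k * d ^ s + j).
  rewrite actpermE /= rcosetE Dg -rcosetM mulgA sigma_tau -mulgA -expgD rcosetM.
  by rewrite rcoset_id // mem_cycle.
rewrite /translation restr_permE ?actE //; last by apply/cosetsP; exists i.
rewrite inE; apply/andP; split; first by rewrite inE.
rewrite inE; apply/fintype.subsetP => _ /cosetsP[k ->].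
by rewrite inE /= /aperm actE; apply/cosetsP; exists (k * d ^ s + j)%N.
Qed.

Lemma etaX_rcoset k i : (eta ^+ k)%g (X (i + k)) = X i.
Proof.
elim: k i => [|k IHk] i; first by rewrite expg0 perm1 addn0.
by rewrite expgS permM addnS eta_def.2 IHk.
Qed.

Lemma etaX_out k (A : {set gal_of {:E}}) : A \notin cosets tau -> (eta ^+ k)%g A = A.
Proof.
move=> nA; elim: k => [|k IHk]; first by rewrite expg0 perm1.
by rewrite expgS permM (out_perm eta_def.1 nA).
Qed.

Lemma eta_order : (eta ^+ p = 1)%g.
Proof.
apply/permP => A; rewrite perm1; have [/cosetsP[i ->]|/etaX_out //] := boolP (A \in cosets tau).
by rewrite -{1}(rcoset_sigma_mod i) -(modnDr i) rcoset_sigma_mod etaX_rcoset.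
Qed.

Lemma etaX_inj (k l : 'I_p) : (eta ^+ k = eta ^+ l)%g -> k = l.
Proof.
move=> eq_eta; have := etaX_rcoset k 0; rewrite eq_eta add0n => D0.
have : (eta ^+ l)%g (X k) = (eta ^+ l)%g (X l) by rewrite D0 -(etaX_rcoset l 0).
move/perm_inj/rcoset_sigma_inj; rewrite !modn_small // => eq_kl.
exact: val_inj.
Qed.

(** [eta] is a unit shift of Z/p, and conjugating it by an affine map of slope d^s gives d^s such
    shifts. *)
Lemma eta_conj g s j : g = (tau ^+ s * sigma ^+ j)%g ->
  (eta ^ translation tau g = eta ^+ (d ^ s))%g.
Proof.
move=> Dg; set t := translation tau g; have t_on : perm_on (cosets tau) t := restr_perm_on _ _.
apply/permP => A; rewrite -(permKV t A) permJ; set B := (t^-1)%g A.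
have [/cosetsP[i DB]|nB] := boolP (B \in cosets tau); last first.
  by rewrite (out_perm eta_def.1 nB) (out_perm t_on nB) etaX_out.
(* [is_eta] gives values at successor exponents only, so the exponent i is raised by p. *)
have {}DB : B = X (i + p.-1).+1.
  by rewrite -addnS prednK // -rcoset_sigma_mod modnDr rcoset_sigma_mod.
by rewrite DB eta_def.2 !(translationE _ Dg) mulSnr addnAC etaX_rcoset.
Qed.

Lemma cycle_etaP n : reflect (exists k : 'I_p, n = (eta ^+ k)%g) (n \in <[eta]>%g).
Proof.
apply: (iffP (cycleP _ _)) => [[k ->]|[k ->]]; last by exists k.
by exists (Ordinal (ltn_pmod k p_gt0)); rewrite /= expg_mod // eta_order.
Qed.

Lemma hopf_gal h g s j k : hopf_algebra tau eta h -> g = (tau ^+ s * sigma ^+ j)%g ->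
  g (h (eta ^+ k)%g) = h (eta ^+ (d ^ s * k))%g.
Proof.
move=> [_ inv_h] Dg.
have /ffunP/(_ (eta ^+ (d ^ s * k))%g) := inv_h g (gal_group_full g).
rewrite ffunE expgM -(eta_conj Dg) -conjXg conjgK => ->.
by rewrite conjXg (eta_conj Dg) -expgM.
Qed.

Lemma coprime_dX s : coprime (d ^ s) p.
Proof.
rewrite coprimeXl // coprime_sym prime_coprime //; apply/negP => p_dvd_d.
have := prim_expr_order d_prim; have -> : (d%:R : 'F_p) = 0.
  by rewrite -(Fp_nat_mod p_prime) (eqP p_dvd_d).
have := prim_order_gt0 d_prim; case: (p.-1) => // m _.
by rewrite exprS mul0r => /eqP; rewrite eq_sym oner_eq0.
Qed.

Lemma reindex_dX s (f : nat -> E) : (forall k, f (k %% p)%N = f k) ->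
  \sum_(k < p) f (d ^ s * k)%N = \sum_(k < p) f k.
Proof.
move=> fmod; pose r (k : 'I_p) := Ordinal (ltn_pmod (d ^ s * k) p_gt0).
have inj_r : injective r.
  by apply: mul_ord_inj; rewrite coprime_sym coprime_dX.
by rewrite [RHS](reindex_inj inj_r) /=; apply: eq_bigr => k _; rewrite fmod.
Qed.

Lemma gal_invariant_alg (x : E) : (forall g : gal_of {:E}, g x = x) -> exists k : K, x = k%:A.
Proof.
move=> fix_x; apply/vlineP; change (x \in 1%VS).
have gal1 : galois 1 {:E}.
  rewrite /galois sub1v normalFieldf andbT /=; apply/separableP => y _.
  apply: pcharf0_separable => q; rewrite !inE; apply/negbTE/negP => /andP[q_pr].
  by rewrite -(rmorph_nat (in_alg E)) fmorph_eq0 (negbTE (nat_neq0 K (prime_gt0 q_pr))).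
by rewrite -(galois_fixedField gal1); apply/fixedFieldP; rewrite ?memvf.
Qed.

Definition hopf_eigen (h : perm_algebra E) (j : nat) : E :=
  \sum_(k < p) h (eta ^+ k)%g * (zeta ^+ j) ^+ k.

(** If g zeta = zeta^(d^s), then g sends the k-th summand to the one of index d^s k, and this
    permutes the residues modulo p. The sum is fixed by the Galois group. *)
Lemma hopf_eigen_alg h j : hopf_algebra tau eta h -> exists k : K, hopf_eigen h j = k%:A.
Proof.
move=> Hh; apply: gal_invariant_alg => g; have [s [i [Dg gz]]] := gal_decomp g.
rewrite /hopf_eigen linear_sum /=.
transitivity (\sum_(k < p) h (eta ^+ (d ^ s * k))%g * (zeta ^+ j) ^+ (d ^ s * k)).
  apply: eq_bigr => k _; rewrite rmorphM /= (hopf_gal k Hh Dg); congr (_ * _).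
  by rewrite !rmorphXn /= gz -!exprM mulnA [(d ^ s * j)%N]mulnC mulnA.
rewrite (reindex_dX s (f := fun k => h (eta ^+ k)%g * (zeta ^+ j) ^+ k)) // => k.
rewrite (expg_mod _ eta_order); congr (_ * _).
by rewrite expr_mod // exprAC (prim_expr_order zeta_prim) expr1n.
Qed.

Lemma hopf_act_expand h (c lam : 'I_p -> K) : (forall j : 'I_p, hopf_eigen h j = (lam j)%:A) ->
  hopf_act p sigma eta h (expand alpha c) = expand alpha (fun j => lam j * c j).
Proof.
move=> Dlam; rewrite /hopf_act /expand.
under eq_bigr do rewrite linear_sum mulr_sumr /=.
rewrite exchange_big; apply: eq_bigr => j _ /=.
rewrite algM -Dlam /hopf_eigen !mulr_suml; apply: eq_bigr => k _.
by rewrite (sigmaX_term sigma_alpha sigma_zeta); ring.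
Qed.

Lemma hopf_eigen_inj h : hopf_algebra tau eta h -> (forall j : 'I_p, hopf_eigen h j = 0) -> h = 0.
Proof.
move=> [supp_h _] h0; apply/ffunP => n; rewrite ffunE.
have [/cycle_etaP[l ->]|/supp_h //] := boolP (n \in <[eta]>%g).
apply: (mulfI pE); rewrite mulr0.
transitivity (\sum_(j < p) hopf_eigen h j * ((zeta ^+ j) ^+ l)^-1); last first.
  by rewrite big1 // => j _; rewrite h0 mul0r.
under eq_bigr do rewrite /hopf_eigen mulr_suml.
rewrite exchange_big (bigD1 l) //= [Y in _ + Y]big1 ?addr0 => [|k neq_kl].
  under eq_bigr do rewrite -mulrA ![_ ^+ _ ^+ l]exprAC -expr_div_n.
  by rewrite -mulr_sumr (sum_prim_exp p_prime zeta_prim) // eqxx mul1n mulrC.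
under eq_bigr do rewrite -mulrA exprAC [_ ^+ _ ^+ l]exprAC -expr_div_n.
rewrite -mulr_sumr (sum_prim_exp p_prime zeta_prim) //.
have -> : (l == k :> nat) = false by rewrite eq_sym; exact: negbTE.
by rewrite mul0n mulr0.
Qed.

(** Inverse Fourier transform. The result is Galois invariant because the [lam j] lie in K. *)
Lemma hopf_eigen_surj (lam : 'I_p -> K) :
  exists2 h, hopf_algebra tau eta h & forall j : 'I_p, hopf_eigen h j = (lam j)%:A.
Proof.
pose v k : E := p%:R^-1 * \sum_(j < p) (lam j)%:A * (zeta ^+ k)^-1 ^+ j.
have vmod k : v (k %% p)%N = v k.
  by congr (_ * _); apply: eq_bigr => j _; rewrite (prim_expr_mod zeta_prim).
(* Summing over the powers of [eta] avoids choosing an exponent for [m], and gives 0 outside the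
   group. *)
pose h : perm_algebra E := [ffun m => \sum_(k < p) (m == (eta ^+ k)%g)%:R * v k].
have hE (l : 'I_p) : h (eta ^+ l)%g = v l.
  rewrite ffunE (bigD1 l) //= eqxx mul1r big1 ?addr0 // => k neq_kl.
  case: eqP => [/etaX_inj eq_lk|_]; last by rewrite mul0r.
  by rewrite eq_lk eqxx in neq_kl.
exists h; last first.
  move=> j; have T i k : (zeta ^+ k)^-1 ^+ i * (zeta ^+ j) ^+ k = (zeta ^+ j / zeta ^+ i) ^+ k.
    by rewrite exprVn [_ ^+ k ^+ i]exprAC mulrC expr_div_n.
  rewrite /hopf_eigen; under eq_bigr do rewrite hE /v -mulrA mulr_suml.
  rewrite -mulr_sumr exchange_big /=.
  under eq_bigr => i _ do under eq_bigr => k _ do rewrite -mulrA T.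
  under eq_bigr do rewrite -mulr_sumr (sum_prim_exp p_prime zeta_prim) //.
  rewrite (bigD1 j) //= eqxx mul1n big1 ?addr0; first by rewrite mulrC mulfK.
  by move=> i neq_ij; rewrite (_ : (i == j :> nat) = false) ?mulr0 //; exact: negbTE.
split=> [n nN|g _].
  rewrite ffunE big1 // => k _; case: eqP => [Dn|_]; last by rewrite mul0r.
  by case/negP: nN; apply/cycle_etaP; exists k.
have [s [i [Dg gz]]] := gal_decomp g.
apply/ffunP => m; rewrite !ffunE linear_sum /=.
transitivity (\sum_(k < p) (m == (eta ^+ (d ^ s * k))%g)%:R * v (d ^ s * k)%N).
  apply: eq_bigr => k _; rewrite rmorphM rmorph_nat /=; congr (_%:R * _).
    rewrite expgM -(eta_conj Dg) -conjXg; congr (nat_of_bool _).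
    by rewrite -(inj_eq (conjg_inj (translation tau g))) conjgKV.
  rewrite /v rmorphM fmorphV rmorph_nat /= linear_sum /=; congr (_ * _).
  apply: eq_bigr => j _; rewrite mulr_algl linearZ /= rmorphXn fmorphV /= rmorphXn /= gz.
  by rewrite -exprM mulr_algl.
rewrite (reindex_dX s (f := fun k => (m == (eta ^+ k)%g)%:R * v k)) // => k.
by rewrite vmod (expg_mod _ eta_order).
Qed.

End HopfStructure.

(** * Free generators of O_L and Kummer data *)

Section Freeness.
Variables (K : fieldExtType rat) (E : splittingFieldType K) (p : nat).
Variables (zeta alpha : E) (L : {subfield E}) (a : K) (d : nat).
Variables (sigma tau : gal_of {:E}) (eta : {perm {set gal_of {:E}}}).
Hypotheses (p_prime : prime p) (zeta_prim : p.-primitive_root zeta).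
Hypothesis p_unramified : unramified_in K p.
Hypothesis L_def : (L : {vspace E}) = <<1; alpha>>%VS.
Hypothesis L_degree : \dim L = p.
Hypothesis a_int : algebraic_integers a.
Hypothesis a_def : alpha ^+ p = a%:A.
Hypothesis a_cong : exists2 c : K, algebraic_integers c & a - 1 = p%:R ^+ 2 * c.
Hypothesis E_def : <<L; zeta>>%VS = fullv.
Hypothesis d_prim : p.-1.-primitive_root (d%:R : 'F_p).
Hypothesis sigma_alpha : sigma alpha = zeta * alpha.
Hypothesis sigma_zeta : sigma zeta = zeta.
Hypothesis tau_alpha : tau alpha = alpha.
Hypothesis tau_zeta : tau zeta = zeta ^+ d.
Hypothesis eta_def : is_eta sigma tau eta.

Local Notation OL := (integers_of L).
Local Notation act := (hopf_act p sigma eta).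
Local Notation A := (associated_order p sigma tau eta L).
Local Notation expand := (@expand K E p alpha).
Local Notation stable := (@stable K E p alpha).

Let p_gt0 : (0 < p)%N := prime_gt0 p_prime.
Let pK : p%:R != 0 :> K. Proof. exact: nat_neq0. Qed.
Let pE : p%:R != 0 :> E.
Proof. by rewrite -(rmorph_nat (in_alg E)) fmorph_eq0. Qed.
Let al0 : alpha != 0 := alpha_neq0 p_prime L_def L_degree.
Let alX0 n : alpha ^+ n != 0 := expf_neq0 n al0.
Let Oal : alpha \in Oint E := alpha_Oint p_prime a_int a_def.

Lemma expand_OL c : expand c \in Oint E -> OL (expand c).
Proof. by move=> Oc; split; [exact: expand_mem | exact/OintP]. Qed.

Lemma OL_expand x : OL x -> exists2 c, x = expand c & expand c \in Oint E.
Proof.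
by move=> [/(expandP L_def L_degree)[c ->] /OintP Ox]; exists c.
Qed.

Lemma expand_eq0 c : expand c = 0 -> forall i, c i = 0.
Proof.
move=> c0; apply: (expand_inj p_prime zeta_prim L_def L_degree sigma_alpha sigma_zeta).
by rewrite c0 /expand big1 // => i _; rewrite scale0r mul0r.
Qed.

Lemma hopf_act_eigen h : hopf_algebra tau eta h -> exists lam : 'I_p -> K,
  (forall c, act h (expand c) = expand (fun i => lam i * c i)) /\
  ((forall i, lam i = 0) -> h = 0).
Proof.
move=> Hh; have [|lam Dlam] := @choice 'I_p K (fun j k => hopf_eigen p zeta eta h j = k%:A).
  move=> j; exact: (hopf_eigen_alg p_prime zeta_prim L_def L_degree a_def E_def d_prim
    sigma_alpha sigma_zeta tau_alpha tau_zeta eta_def).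
exists lam; split.
- by move=> c; apply: (hopf_act_expand sigma_alpha sigma_zeta).
- move=> lam0.
  apply: (hopf_eigen_inj p_prime zeta_prim L_def L_degree a_def E_def d_prim
    sigma_alpha sigma_zeta tau_alpha tau_zeta eta_def Hh) => j.
  by rewrite Dlam lam0 scale0r.
Qed.

Lemma order_stable h lam : A h ->
  (forall c, act h (expand c) = expand (fun i => lam i * c i)) -> stable lam.
Proof.
move=> [_ Ah] Dh c Oc; rewrite -Dh; apply/OintP.
by have [] := Ah _ (expand_OL Oc).
Qed.

Lemma stable_order lam : stable lam -> exists2 h, A h &
  forall c, act h (expand c) = expand (fun i => lam i * c i).
Proof.
move=> st; have [h Hh Dh] := hopf_eigen_surj p_prime zeta_prim L_def L_degree a_def E_def
  d_prim sigma_alpha sigma_zeta tau_alpha tau_zeta eta_def lam.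
have DAh c := hopf_act_expand sigma_alpha sigma_zeta c Dh.
exists h => //; split=> // x /OL_expand[c -> Oc].
by rewrite DAh; apply/expand_OL/st.
Qed.

(** Spanning is [generator_stable]. For freeness, no coordinate of the mean vanishes, so an h that
    annihilates it has all eigenvalues 0. *)
Lemma generator_free (u : 'I_p -> E) :
  (forall i, exists k : K, u i = k%:A * alpha ^+ i) -> (forall i, u i \in Oint E) ->
  (forall (i : 'I_p) (k : K), k%:A * alpha ^+ i \in Oint E ->
     exists2 m, m \in Oint K & k%:A * alpha ^+ i = m%:A * u i) ->
  p%:R^-1 * \sum_i u i \in Oint E ->
  is_free_generator act A OL (p%:R^-1 * \sum_i u i).
Proof.
move=> hom_u Ou gen_u Omean; have [k Dk] := choice hom_u.
have Dmean mu : p%:R^-1 * (\sum_i (mu i)%:A * u i) = expand (fun i => mu i * (k i / p%:R)).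
  rewrite /expand mulr_sumr; apply: eq_bigr => i _.
  by rewrite Dk !algM algV alg_nat; ring.
have D1 : p%:R^-1 * \sum_i u i = expand (fun i => k i / p%:R).
  transitivity (expand (fun i => 1 * (k i / p%:R))).
    by rewrite -Dmean; under [in RHS]eq_bigr do rewrite scale1r mul1r.
  by apply: eq_expand => i; rewrite mul1r.
have k0 i : k i != 0.
  have [|m _] := gen_u i 1; first by rewrite scale1r mul1r rpredX.
  rewrite scale1r mul1r Dk => Dm; apply/eqP => ki0; case/eqP: (alX0 i).
  by rewrite Dm ki0 scale0r mul0r mulr0.
set theta := p%:R^-1 * _ in Omean D1 *.
split.
- by move=> _ ->; rewrite D1; apply: expand_OL; rewrite -D1.
- move=> y /OL_expand[c -> Oc].
  have [mu Dmu st] := generator_stable p_prime zeta_prim p_unramified L_def L_degree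
    a_int a_def a_cong sigma_alpha sigma_zeta hom_u Ou gen_u Omean Oc.
  have [h Ah Dh] := stable_order st; exists [:: theta], (fun=> h); split.
    by move=> x; rewrite mem_seq1 => /eqP->.
  by rewrite big_seq1 D1 Dh Dmu Dmean.
- move=> s h uniq_s sA sum0 x sx; have [Bx Ahx] := sA x sx.
  (* A nonempty list without repetition in a singleton has exactly one entry. *)
  have {}sum0 : act (h theta) theta = 0.
    case: s uniq_s sA sum0 sx => // x1 s /= /andP[nx1 _] sA.
    have Dx1 : x1 = theta by have [] := sA x1 (mem_head _ _).
    case: s nx1 sA => [_ _|x2 s nx1 sA]; first by rewrite big_seq1 Dx1.
    have [|Dx2 _] := sA x2; first by rewrite !inE eqxx orbT.
    by move: nx1; rewrite Dx1 Dx2 mem_head.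
  rewrite Bx in Ahx *; set ht := h theta in Ahx sum0 *; have [Hh _] := Ahx.
  have [lam [Dh lam_h]] := hopf_act_eigen Hh.
  apply: lam_h => i; move: sum0; rewrite D1 Dh => /expand_eq0/(_ i)/eqP.
  by rewrite !mulf_eq0 invr_eq0 (negbTE (k0 i)) (negbTE pK) !orbF => /eqP.
Qed.

(** Here beta = k0 alpha^r with r prime to p, so beta^j lies on the line of alpha^(r j mod p). By
    the condition on associated ideals beta^j / b_j generates the integers of that line, and
    [generator_free] applies after reindexing. *)
Lemma freeness_data_generator (beta : E) (b : K) (bs : 'I_p -> K) :
  freeness_data L beta b bs -> is_free_generator act A OL (p%:R^-1 * kummer_sum beta bs).
Proof.
case=> [[Lbeta /OintP Obeta] gen_beta Ob Db Obs assoc [y [_ /OintP Oy] Dy]].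
have beta0 : beta != 0.
  apply/eqP => beta0; have := prime_gt1 p_prime.
  by rewrite -L_degree -gen_beta beta0 Fadjoin0 dimv1.
have b0 : b != 0 by rewrite -(alg_eq0 E) -Db expf_neq0.
have [r [k0 Dbeta]] := kummer_eigen p_prime zeta_prim L_def L_degree sigma_alpha sigma_zeta
  Lbeta beta0 Db.
(* r = 0 would put beta in K, against the degree p of K(beta). *)
have co_r : coprime p r.
  rewrite prime_coprime // gtnNdvd // lt0n; apply/eqP => r0.
  have: \dim <<1; beta>> = 1%N; last first.
    by rewrite gen_beta L_degree => p1; have := prime_gt1 p_prime; rewrite p1.
  rewrite (_ : <<1; beta>>%VS = 1%VS) ?dimv1 //; apply/Fadjoin_idP.
  by rewrite Dbeta r0 mulr1 rpredZ ?rpred1.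
have bs0 j : bs j != 0.
  have [[_ [x Bx x0]] _] := ideal_val_associated p j (nzideal_principal Ob b0).
  by move: Bx; rewrite assoc => -[z _ Dx]; apply: contra_neq x0 => bsj0; rewrite -Dx bsj0 mul0r.
have inv_bs (j : 'I_p) k :=
  proj1 (associated_ideal_principalP j p_gt0 Ob b0 (Obs j) (bs0 j)) (assoc j) k.
pose f (j : 'I_p) := Ordinal (ltn_pmod (r * j) p_gt0).
have inj_f : injective f by apply: mul_ord_inj.
(* From alpha^(r j) = a^q alpha^(r j mod p), with q the quotient of r j by p. *)
pose kappa (j : 'I_p) : K := k0 ^+ j * a ^+ ((r * j) %/ p).
have Dkappa (j : 'I_p) : beta ^+ j = (kappa j)%:A * alpha ^+ f j.
  rewrite Dbeta exprMn -exprM {1}(divn_eq (r * j) p) exprD [(_ %/ p * p)%N]mulnC exprM.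
  by rewrite a_def /kappa algM !algX mulrA.
have kappa0 j : kappa j != 0.
  have : beta ^+ j != 0 by rewrite expf_neq0.
  by rewrite Dkappa mulf_eq0 negb_or alg_eq0 => /andP[].
pose u (j : 'I_p) := beta ^+ j / (bs j)%:A.
pose u' i := u (invF inj_f i).
have sum_u : \sum_i u' i = kummer_sum beta bs.
  by rewrite (reindex_inj inj_f); apply: eq_bigr => j _; rewrite /u' invF_f.
rewrite -sum_u; apply: generator_free.
- move=> i; exists (kappa (invF inj_f i) / bs (invF inj_f i)).
  by rewrite /u' /u Dkappa f_invF algM algV mulrAC.
- move=> i; apply: (OintX p_gt0); rewrite /u' /u; set j := invF _ _.
  rewrite expr_div_n exprAC Db -!algX -algV -algM Oint_alg mulrC -exprVn; apply/OintP.
  by apply/inv_bs; rewrite (mulVf (bs0 j)); exact: O1.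
- move=> i k; rewrite -[i](f_invF inj_f); set j := invF _ _ => Ok.
  have Dk : k%:A * alpha ^+ f j = (k / kappa j)%:A * beta ^+ j.
    by rewrite Dkappa mulrA -algM (divfK (kappa0 j)).
  exists (k / kappa j * bs j); last first.
    by rewrite Dk /u' /u invF_f !algM; field; rewrite alg_eq0.
  apply/OintP; apply: (proj1 (inv_bs j _)); apply/OintP.
  rewrite -(Oint_alg E) algM !algX -Db exprAC -exprMn -Dk.
  exact: rpredX.
- by rewrite sum_u Dy mulKf.
Qed.

(** A basis is an arbitrary set, so it must be shown to be a singleton. The components of two
    elements on one line satisfy a nontrivial relation over O_K; p times the projection onto that
    line, scaled by its coefficients, turns it into a relation over the associated order. *)
Lemma free_generator_expand : is_free_module act A OL ->
  exists2 c, expand c \in Oint E & forall c', expand c' \in Oint E ->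
    exists2 lam, stable lam & forall i, c' i = lam i * c i.
Proof.
case=> B basis; have [subB spanB freeB] := basis.
have uniqB x y : B x -> B y -> x = y.
  move=> Bx By; apply: contrapT => /eqP neq_xy.
  have [c Dx _] := OL_expand (subB x Bx); have [c' Dy _] := OL_expand (subB y By).
  pose j := Ordinal p_gt0.
  have [m [n [Om On mn0 Dmn]]] : exists m n, [/\ m \in Oint K, n \in Oint K,
      (m != 0) || (n != 0) & m * c j + n * c' j = 0].
    have [c'0|c'0] := eqVneq (c' j) 0.
      by exists 0, 1; rewrite rpred0 rpred1 oner_eq0 orbT c'0 mul0r mulr0 addr0.
    have [n n_gt0 On] := Oint_fraction (c j / c' j).
    exists n%:R, (- (n%:R * (c j / c' j))); split; rewrite ?rpred_nat ?rpredN //.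
      by rewrite nat_neq0.
    by rewrite mulNr -mulrA divfK // subrr.
  have [hx Ahx Dhx] :=
    stable_order (single_stable p_prime zeta_prim sigma_alpha sigma_zeta j Om).
  have [hy Ahy Dhy] :=
    stable_order (single_stable p_prime zeta_prim sigma_alpha sigma_zeta j On).
  pose h z := if z == x then hx else hy.
  have hsum : \sum_(z <- [:: x; y]) act (h z) z = 0.
    rewrite big_cons big_seq1 /h eqxx eq_sym (negbTE neq_xy) Dx Dy Dhx Dhy.
    rewrite /expand -big_split big1 //= => i _; rewrite -mulrDl -scalerDl.
    case: eqP => [->|_]; last by rewrite !mul0r addr0 scale0r mul0r.
    by rewrite -!mulrA -mulrDr Dmn mulr0 scale0r mul0r.
  have h0 z : z \in [:: x; y] -> h z = 0.
    apply: freeB hsum z => [|z].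
      by rewrite /= mem_seq1 neq_xy.
    by rewrite !inE /h => /orP[]/eqP->; rewrite ?eqxx // eq_sym (negbTE neq_xy).
  have nz q hz : A hz -> (forall c, act hz (expand c) =
      expand (fun i => (if i == j then p%:R * q else 0) * c i)) -> hz = 0 -> q = 0.
    move=> _ Dhz hz0.
    have : act hz (expand (fun=> 1)) = 0.
      by rewrite hz0 /hopf_act big1 // => k _; rewrite ffunE mul0r.
    rewrite Dhz => /expand_eq0/(_ j)/eqP; rewrite eqxx mulr1 mulf_eq0 (negbTE pK).
    by move/eqP.
  have hx0 : hx = 0 by have := h0 x (mem_head _ _); rewrite /h eqxx.
  have hy0 : hy = 0.
    by have := h0 y; rewrite !inE eqxx orbT /h eq_sym (negbTE neq_xy); apply.
  by move: mn0; rewrite (nz _ _ Ahx Dhx hx0) (nz _ _ Ahy Dhy hy0) eqxx.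
have [x Bx] : exists x, B x.
  have [|s [h [sB D1]]] := spanB 1.
    by split; [exact: mem1v | apply/OintP; exact: rpred1].
  case: s sB D1 => [_ /eqP|x s sB _]; first by rewrite big_nil oner_eq0.
  by exists x; have [] := sB x (mem_head _ _).
have [c Dx Oc] := OL_expand (subB x Bx); exists c => // c' Oc'.
have [s [h [sB Dc']]] := spanB _ (expand_OL Oc').
(* The spanning list may repeat its entries, and [h] depends on the entry alone, so the sum is
   [size s] copies of one term. *)
have sx z : z \in s -> z = x by move=> /sB[Bz _]; apply: uniqB.
have {}Dc' : expand c' = act (h x) x *+ size s.
  rewrite Dc' big_seq (eq_bigr (fun=> act (h x) x)) => [|z /sx -> //].
  by rewrite -big_seq big_const_seq count_predT iter_addr_0.
(* That [h x] lies in the associated order is known only through an entry of [s]. For the empty list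
   the element is 0 and zero eigenvalues serve. *)
case: s sB Dc' {sx} => [|z s] sB Dc'.
  exists (fun=> 0) => [c1 _|i].
    by rewrite /expand big1 ?rpred0 // => i _; rewrite mul0r scale0r mul0r.
  by rewrite mul0r; apply: expand_eq0; rewrite Dc'.
have [Bz] := sB z (mem_head _ _); rewrite (uniqB z x) //.
move: (h x) Dc' => hx Dc' Ah; have [Hh _] := Ah.
have [lam [Dh _]] := hopf_act_eigen Hh; have st := order_stable Ah Dh.
exists (fun i => lam i *+ (size s).+1) => [c1 /st Oc1|].
  rewrite (_ : expand _ = expand (fun i => lam i * c1 i) *+ (size s).+1) ?rpredMn //.
  by rewrite /expand -sumrMnl; apply: eq_bigr => i _; rewrite mulrnAl -scalerMnl mulrnAl.
apply: (expand_inj p_prime zeta_prim L_def L_degree sigma_alpha sigma_zeta).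
rewrite Dc' Dx Dh /expand -sumrMnl; apply: eq_bigr => i _.
by rewrite mulrnAl -scalerMnl mulrnAl.
Qed.

(** Each u_i = p c_i alpha^i generates the integers of its line: an operator reaching k alpha^i is
    supported at i, so p divides its eigenvalue by [stable_single_Oint]. The b_j are then defined by
    beta^j = b_j u_j. *)
Lemma free_freeness_data : is_free_module act A OL ->
  exists (beta : E) (b : K) (bs : 'I_p -> K), freeness_data L beta b bs.
Proof.
case/free_generator_expand => c Oc gen_c.
pose u i := p%:R * ((c i)%:A * alpha ^+ i).
have Ou i : u i \in Oint E.
  exact: (expand_component_Oint p_prime zeta_prim sigma_alpha sigma_zeta).
have gen_u (i : 'I_p) (k : K) : k%:A * alpha ^+ i \in Oint E ->
    exists2 m, m \in Oint K & k%:A * alpha ^+ i = m%:A * u i.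
  rewrite -expand_single => /gen_c[lam st Dlam].
  (* alpha^l is itself an integer of L, so the generator has a nonzero component on its line. *)
  have c_neq0 l : c l != 0.
    have : expand (fun i => if i == l then 1 else 0) \in Oint E.
      by rewrite expand_single scale1r mul1r rpredX.
    case/gen_c => mu _ /(_ l); rewrite eqxx => Dmu; apply/eqP => cl0.
    by move/eqP: Dmu; rewrite cl0 mulr0 oner_eq0.
  have lam0 l : l != i -> lam l = 0.
    move=> /negbTE neq_li; have /esym/eqP := Dlam l.
    by rewrite neq_li mulf_eq0 (negbTE (c_neq0 l)) orbF => /eqP.
  exists (lam i / p%:R).
    exact: (stable_single_Oint p_prime zeta_prim L_def L_degree a_int a_def a_cong st lam0).
  rewrite expand_single; have := Dlam i; rewrite eqxx => ->.
  by rewrite /u !algM algV alg_nat; field.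
have u_neq0 i : u i != 0.
  have [|m _] := gen_u i 1; first by rewrite scale1r mul1r rpredX.
  rewrite scale1r mul1r => Dm; apply/eqP => ui0; case/eqP: (alX0 i).
  by rewrite Dm ui0 mulr0.
(* The index 1 places beta^j on the line of alpha^j, which avoids reindexing. *)
pose i1 := Ordinal (prime_gt1 p_prime); pose k1 := p%:R * c i1.
have Dbeta : u i1 = k1%:A * alpha by rewrite /u /k1 algM alg_nat mulrA.
have k1_neq0 : k1 != 0.
  by rewrite -(alg_eq0 E); apply: contra_neq (u_neq0 i1) => k10; rewrite Dbeta k10 mul0r.
pose b := k1 ^+ p * a.
have Db : u i1 ^+ p = b%:A by rewrite Dbeta exprMn a_def /b algM algX.
have Ob : b \in Oint K by rewrite -(Oint_alg E) -Db rpredX.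
have b_neq0 : b != 0 by rewrite -(alg_eq0 E) -Db expf_neq0.
have betaX j : u i1 ^+ j = (k1 ^+ j)%:A * alpha ^+ j by rewrite Dbeta exprMn algX.
have [|bs Hbs] := @choice 'I_p K (fun j m => m \in Oint K /\ u i1 ^+ j = m%:A * u j).
  move=> j; have : (k1 ^+ j)%:A * alpha ^+ j \in Oint E by rewrite -betaX rpredX.
  by case/gen_u => m Om Dm; exists m; rewrite betaX.
have Obs j : bs j \in Oint K by have [] := Hbs j.
have Dbs (j : 'I_p) : u i1 ^+ j = (bs j)%:A * u j by have [] := Hbs j.
have bs_neq0 j : bs j != 0.
  have : u i1 ^+ j != 0 by rewrite expf_neq0.
  by rewrite Dbs mulf_eq0 negb_or alg_eq0 => /andP[].
exists (u i1), b, bs; split.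
- split; last exact/OintP.
  by rewrite Dbeta mulr_algl memvZ // L_def memv_adjoin.
- apply/eqP; rewrite L_def eqEsubv !sub_adjoin1v Dbeta mulr_algl memvZ ?memv_adjoin //=.
  rewrite -[X in X \in _](scalerK k1_neq0) memvZ //; exact: memv_adjoin.
- exact/OintP.
- exact: Db.
- by move=> j; apply/OintP.
- move=> j /=; apply/(associated_ideal_principalP j p_gt0 (Oint_O Ob) b_neq0
    (Oint_O (Obs j)) (bs_neq0 j)).
  (* k^p b^j is the p-th power of k beta^j = (k b_j) u_j, which is integral exactly when k b_j is,
     because u_j generates its line. *)
  move=> k; have Dk : (k ^+ p * b ^+ j)%:A = (k%:A * u i1 ^+ j) ^+ p.
    by rewrite algM !algX -Db [RHS]exprMn; congr (_ * _); exact: exprAC.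
  have Dkj : k%:A * u i1 ^+ j = (k * bs j)%:A * u j by rewrite Dbs mulrA -algM.
  split=> /OintP Ok; apply/OintP.
    move: Ok; rewrite -(Oint_alg E) Dk => /(OintX p_gt0).
    rewrite betaX mulrA -algM => /gen_u[m Om].
    by rewrite algM -mulrA -betaX Dkj => /(mulIf (u_neq0 j))/alg_inj ->.
  by rewrite -(Oint_alg E) Dk Dkj rpredX // rpredM ?Oint_alg.
- exists (expand c); first exact: expand_OL.
  rewrite /kummer_sum mulr_sumr; apply: eq_bigr => j _.
  by rewrite Dbs /u mulrAC divff ?mul1r // alg_eq0.
Qed.

End Freeness.

Theorem theorem5p5
  (K : fieldExtType rat) (E : splittingFieldType K) (p : nat)
  (zeta alpha : E) (L : {subfield E}) (a : K)
  (d : nat) (sigma tau : gal_of {:E})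
  (eta : {perm {set gal_of {:E}}})
  (p_prime : prime p)
  (zeta_prim : p.-primitive_root zeta)
  (zeta_notin_K : zeta \notin 1%VS)
  (p_unramified : unramified_in K p)
  (L_def : (L : {vspace E}) = <<1; alpha>>%VS)
  (L_degree : \dim L = p)
  (alpha_int : integers_of L alpha)
  (a_int : algebraic_integers a)
  (a_def : alpha ^+ p = a%:A)
  (a_cong : exists2 c : K, algebraic_integers c & a - 1 = p%:R ^+ 2 * c)
  (L_tame : tamely_ramified L)
  (E_def : <<L; zeta>>%VS = fullv)
  (d_prim : p.-1.-primitive_root (d%:R : 'F_p))
  (sigma_alpha : sigma alpha = zeta * alpha)
  (sigma_zeta : sigma zeta = zeta)
  (tau_alpha : tau alpha = alpha)
  (tau_zeta : tau zeta = zeta ^+ d)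
  (eta_def : is_eta sigma tau eta) :
  let OL := integers_of L in
  let act := hopf_act p sigma eta in
  let A := associated_order p sigma tau eta L in
  (is_free_module act A OL <->
     exists (beta : E) (b : K) (bs : 'I_p -> K), freeness_data L beta b bs) /\
  (forall (beta : E) (b : K) (bs : 'I_p -> K), freeness_data L beta b bs ->
     is_free_generator act A OL (p%:R^-1 * kummer_sum beta bs)).
Proof.
move=> OL act A; have gen := freeness_data_generator p_prime zeta_prim p_unramified
  L_def L_degree a_int a_def a_cong E_def d_prim sigma_alpha sigma_zeta tau_alpha
  tau_zeta eta_def.
split=> //; split=> [|[beta [b [bs data]]]].
  exact: (free_freeness_data p_prime zeta_prim L_def L_degree a_int a_def a_cong E_def
    d_prim sigma_alpha sigma_zeta tau_alpha tau_zeta eta_def).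
by exists [set p%:R^-1 * kummer_sum beta bs]%classic; apply: gen data.
Qed.
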